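(* Let the probability distribution $\mu$ on $\mathbb{R}$ be such that for $X\sim\mu$ it holds that $\mathbb{E}[X^2]<\infty$ and $\sigma^2:=\operatorname{Var}(X)>0$, and assume further that the absolutely continuous part $\mu_{ac}$ of $\mu$ has a Lebesgue density which is strictly positive on $I=(\operatorname{ess\,inf}(X),\operatorname{ess\,sup}(X))$. Suppose that, for some $n\in\mathbb{N}$ (with $n\ge 1$), $X_1,\dotsc,X_n$ are independent random variables on a probability space $(\Omega,\mathcal{F},\mathbb{P})$ such that $X_j\sim\mu$ for $1\leq j\leq n$, and define $S_n:=\sum_{j=1}^n X_j$. Then, with $m:=\mathbb{E}[X_1]$, $S_n^*:=\sigma^{-1}n^{-1/2}(S_n-nm)$ and $Z$ a standard normal random variable, it holds that $$d_{\mathrm{TV}}(S_n^*,Z)\leq \frac{2}{\sigma^2\sqrt{n}}\Bigl(\operatorname{Var}\bigl(\tau_X(X)\bigr)\Bigr)^{1/2},$$ where $\tau_X$ is the Stein kernel for $X$ (which, under these assumptions, exists and is $\mu$-a.e. unique).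
   Context: Stein kernel: for a real random variable $X$ with $\mathbb{E}|X|<\infty$, distribution $\mu$ and mean $m$, a Borel-measurable function $\tau_X:\mathbb{R}\to\mathbb{R}$ is called a Stein kernel for $X$ (or for $\mu$) if $$\mathbb{E}[\tau_X(X)f'(X)]=\mathbb{E}[(X-m)f(X)]$$ for all continuously differentiable $f:\mathbb{R}\to\mathbb{R}$ with bounded derivative $f'$ (the expectations being required to exist; with $f(x)=x$ this includes $\mu$-integrability of $\tau_X$). Essential bounds: $\operatorname{ess\,inf}(X)=\sup\{t\in\mathbb{R}:\mathbb{P}(X<t)=0\}\in[-\infty,\infty)$ and $\operatorname{ess\,sup}(X)=\inf\{t\in\mathbb{R}:\mathbb{P}(X>t)=0\}\in(-\infty,\infty]$. Lebesgue decomposition: $\mu=\mu_{ac}+\mu_s$ with $\mu_{ac}$ absolutely continuous and $\mu_s$ singular with respect to Lebesgue measure. Total variation distance: for real random variables $U,V$, $d_{\mathrm{TV}}(U,V)=\sup_{B\in\mathcal{B}(\mathbb{R})}|\mathbb{P}(U\in B)-\mathbb{P}(V\in B)|$ (the distance of their laws). The variance $\operatorname{Var}(\tau_X(X))$ takes values in $[0,\infty]$; it equals $+\infty$ if $\tau_X(X)$ is not square-integrable, and the bound is then trivial. *)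

(* Defs.v *)
From HB Require Import structures.
From mathcomp Require Import all_boot all_order all_algebra.
From mathcomp Require Import all_classical all_reals all_analysis.

Set Implicit Arguments.
Unset Strict Implicit.
Unset Printing Implicit Defensive.

Import Order.TTheory GRing.Theory Num.Theory.
Import numFieldNormedType.Exports.

Local Open Scope classical_set_scope.
Local Open Scope ring_scope.
Local Open Scope ereal_scope.

Definition mutually_singular (d : measure_display) (T : measurableType d)
    (R : realType) (m1 m2 : {measure set T -> \bar R}) : Prop :=
  exists N : set T, [/\ measurable N, m1 (~` N) = 0 & m2 N = 0].

Definition lebesgue_decomposition (R : realType)
    (mu mu_ac mu_s : {measure set (measurableTypeR R) -> \bar R}) : Prop :=
  [/\ mu_ac `<< (@lebesgue_measure R),
      mutually_singular mu_s (@lebesgue_measure R)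
    & forall A, measurable A -> mu A = mu_ac A + mu_s A].

Definition has_density (R : realType)
    (m : {measure set (measurableTypeR R) -> \bar R}) (p : R -> R) : Prop :=
  [/\ measurable_fun [set: R] p, (forall x, (0 <= p x)%R)
    & forall A, measurable A -> m A = \int[lebesgue_measure]_(x in A) (p x)%:E].

Definition has_law (R : realType) (d : measure_display) (T : measurableType d)
    (P : probability T R) (X : {RV P >-> R})
    (mu : probability (measurableTypeR R) R) : Prop :=
  forall A, measurable A -> distribution P X A = mu A.

Definition independent_RVs (R : realType) (d : measure_display)
    (T : measurableType d) (P : probability T R) (n : nat)
    (X : 'I_n -> {RV P >-> R}) : Prop :=
  forall (J : {set 'I_n}) (B : 'I_n -> set R),
    (forall j, measurable (B j)) ->
    P (\bigcap_(j in [set` J]) (X j @^-1` B j)) =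
    \prod_(j in J) P (X j @^-1` B j).

(* [X] is meant to be integrable: [fine 'E_P[X]] is then its mean. *)
Definition stein_kernel (R : realType) (d : measure_display)
    (T : measurableType d) (P : probability T R) (X : {RV P >-> R})
    (tau : R -> R) : Prop :=
  measurable_fun [set: R] tau /\
  forall f : R -> R,
    (forall x, derivable f x 1%R) ->
    continuous (derive1 f) ->
    (exists M : R, forall x, (`|derive1 f x| <= M)%R) ->
    [/\ P.-integrable [set: T]
          (EFin \o (fun w => tau (X w) * derive1 f (X w))%R),
        P.-integrable [set: T]
          (EFin \o (fun w => (X w - fine 'E_P[X]) * f (X w))%R)
      & 'E_P[fun w => (tau (X w) * derive1 f (X w))%R] =
        'E_P[fun w => ((X w - fine 'E_P[X]) * f (X w))%R]].

Definition dTV (R : realType) (d d' : measure_display)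
    (T : measurableType d) (T' : measurableType d')
    (P : probability T R) (P' : probability T' R)
    (U : T -> R) (V : T' -> R) : \bar R :=
  ereal_sup [set `|P (U @^-1` B) - P' (V @^-1` B)| | B in @measurable _ R].

(* Main.v *)
Require Import Defs.
From HB Require Import structures.
From mathcomp Require Import all_boot all_order all_algebra.
From mathcomp Require Import all_classical all_reals all_analysis.
From mathcomp Require Import ess_sup_inf measurable_realfun.
From mathcomp Require Import ring lra.

Set Implicit Arguments.
Unset Strict Implicit.
Unset Printing Implicit Defensive.

Import Order.TTheory GRing.Theory Num.Theory.
Import numFieldNormedType.Exports.

Local Open Scope classical_set_scope.
Local Open Scope ring_scope.
Local Open Scope ereal_scope.

(** The bound is an instance of Stein's method in which the Stein kernel does
    the work of Gaussian integration by parts.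

    For a test function [h] with values in [[0, 1]], let [f] solve the Stein
    equation [f' x - x * f x = h x - N h], where [N h] is the Gaussian mean of
    [h]. Evaluating it at the normalised sum [S] and taking expectations gives
    [E (h S) - N h = E (f' S) - E (S * f S)]. Conditionally on the other
    summands, [f] composed with [S] is a test function of one summand, so the
    defining identity of the kernel applies to each summand separately
    ([coordinate_identity]) and adds up to [E (S * f S) = E (W * f' S)], where
    [W] is the multiple of the sum of the [tau (X_j)] that has mean 1. As
    [f'] is bounded by 2 ([stein_solution]), the error is at most
    [2 * E `|1 - W|] ([stein_discrepancy]), and [W] is an average of [n]
    independent copies of a variable of mean 1, so [E `|1 - W|] is at most the
    standard deviation of one copy divided by the square root of [n]
    ([mean_discrepancy]).

    The only delicate point is that the kernel identity is available for
    continuously differentiable test functions, whereas the solution attached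
    to an indicator function has a derivative that jumps on a set which may
    carry mass. The argument is therefore run for continuous [h], where [f] is
    of class C1, and total variation is recovered afterwards: indicators of
    Borel sets are limits in mean of continuous functions with values in
    [[0, 1]], for any finite measure ([continuous_approximation]), so that
    these functions already compute the distance
    ([probability_dist_continuous]).

    Existence. If [between (x, y)] says that [x] lies between the mean [m] and
    [y], then Fubini's theorem turns [E ((X - m) * f X)] into the Lebesgue
    integral of [h * f'], where [h x] is the mean of [`|X - m|] on the event
    [between (x, X)] ([integral_hoeffding_derive1]). Off a Lebesgue null set
    [h] vanishes outside the interval where the density [p] is positive
    ([hoeffding_kernel_support]), so [h / p], set to 0 on the null set that
    carries the singular part, is a kernel ([law_stein_kernel_exists]).

    Uniqueness. The difference of two kernels integrates to 0 against every
    bounded continuous function that has an antiderivative of the admissible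
    class, and products of a continuous function with the Gaussian density are
    of this kind; by the same approximation of indicators the difference
    vanishes almost everywhere ([law_stein_kernel_unique]). *)

(** * Differentiable functions on the line *)

Lemma derivable_continuous (R : realType) (f : R -> R) :
  (forall x, derivable f x 1%R) -> continuous f.
Proof.
by move=> df x; apply: differentiable_continuous; exact/derivable1_diffP.
Qed.

Lemma derive1_id (R : realType) : derive1 (id : R -> R) = cst 1%R.
Proof. by apply/funext => x; rewrite derive1E derive_id. Qed.

Lemma derive1_affine (R : realType) (f : R -> R) (c y x : R) :
  (forall t, derivable f t 1%R) ->
  is_derive x 1%R (fun t => f (c * t + y)%R) (c * derive1 f (c * x + y))%R.
Proof.
move=> df; have h : is_derive x 1%R (fun t => c * t + y)%R c.
  by apply: is_derive_eq; rewrite /GRing.scale/= mulr1 addr0.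
have h2 : is_derive (c * x + y)%R 1%R f (derive1 f (c * x + y)).
  by rewrite derive1E; exact: DeriveDef.
by have := @is_derive1_comp R f (fun t => c * t + y)%R x _ _ h2 h; rewrite mulrC.
Qed.

Lemma derive1_bounded_lipschitz (R : realType) (f : R -> R) (M : R) :
  (forall x, derivable f x 1%R) -> (forall x, (`|derive1 f x| <= M)%R) ->
  forall x y, (`|f y - f x| <= M * `|y - x|)%R.
Proof.
move=> df f'M x y; wlog xy : x y / (x <= y)%R => [h|].
  have [|/ltW yx] := leP x y; first exact: h.
  by rewrite distrC [(`|y - x|)%R]distrC; exact: h.
have [||c _ ->] := @MVT_segment R f (derive1 f) x y xy.
- by move=> t _; rewrite derive1E; exact: DeriveDef.
- by apply: derivable_within_continuous => t _; exact: df.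
by rewrite normrM ler_wpM2r.
Qed.

Lemma is_derive_integralNy (R : realType) (k : R -> R) : continuous k ->
  (@lebesgue_measure R).-integrable setT (EFin \o k) -> forall x : R,
  is_derive x 1%R
    (fun x => \int[lebesgue_measure]_(t in `]-oo, x]) k t)%R (k x).
Proof.
move=> ck ik x; have := @continuous_FTC1 R k -oo%O x (x + 1)%R.
rewrite ltrDl ltr01 => /(_ isT) [].
- by apply: integrableS ik.
- by rewrite ltNyr.
- exact: ck.
by move=> dF <-; rewrite derive1E; exact: DeriveDef.
Qed.

(** * Integrals of real functions *)

Section RintegralExtra.
Local Open Scope ring_scope.
Context d (T : measurableType d) (R : realType).
Variable mu : {measure set T -> \bar R}.

Lemma integrable_Rsum (I : Type) (s : seq I) (f : I -> T -> R) :
  (forall i, mu.-integrable setT (EFin \o f i)) ->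
  mu.-integrable setT (EFin \o (fun x => \sum_(i <- s) f i x)).
Proof.
move=> fi; rewrite (_ : EFin \o _ = fun x => (\sum_(i <- s) (f i x)%:E)%E).
  apply: (@integrable_sum _ _ _ mu setT measurableT I s xpredT
    (fun i x => (f i x)%:E)) => i _; exact: fi.
by apply/funext => x; rewrite /= sumEFin.
Qed.

Lemma Rintegral_sum (I : Type) (s : seq I) (f : I -> T -> R) :
  (forall i, mu.-integrable setT (EFin \o f i)) ->
  \int[mu]_x (\sum_(i <- s) f i x) = \sum_(i <- s) \int[mu]_x f i x.
Proof.
move=> fi; elim: s => [|i s ih].
  under eq_Rintegral do rewrite big_nil.
  by rewrite big_nil (@Rintegral_cst _ _ _ mu setT measurableT 0) mul0r.
under eq_Rintegral do rewrite big_cons.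
by rewrite RintegralD// ?ih ?big_cons//; exact: integrable_Rsum.
Qed.

Lemma integrable_scaled (c : R) (f : T -> R) :
  mu.-integrable setT (EFin \o f) ->
  mu.-integrable setT (EFin \o (fun x => c * f x)).
Proof. by move=> fi; exact: (integrableZl _ c fi). Qed.

Lemma integrable_Radd (f g : T -> R) :
  mu.-integrable setT (EFin \o f) -> mu.-integrable setT (EFin \o g) ->
  mu.-integrable setT (EFin \o (fun x => f x + g x)).
Proof. by move=> fi gi; exact: (integrableD _ fi gi). Qed.

Lemma integrable_Rsub (f g : T -> R) :
  mu.-integrable setT (EFin \o f) -> mu.-integrable setT (EFin \o g) ->
  mu.-integrable setT (EFin \o (fun x => f x - g x)).
Proof. by move=> fi gi; exact: (integrableB _ fi gi). Qed.

Lemma integrable_boundedM (K : R) (f k : T -> R) :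
  mu.-integrable setT (EFin \o f) -> measurable_fun setT k ->
  (forall x, `|k x| <= K) ->
  mu.-integrable setT (EFin \o (fun x => f x * k x)).
Proof.
move=> fi mk kK; apply: (le_integrable _ _ _ (integrable_scaled K fi)) => //.
  apply/measurable_EFinP; apply: measurable_funM => //.
  by apply/measurable_EFinP; exact: measurable_int fi.
move=> x _ /=; rewrite lee_fin !normrM mulrC ler_wpM2r//.
by rewrite (le_trans (kK x))// ler_norm.
Qed.

End RintegralExtra.

Lemma Rintegral_cst_probability d (T : measurableType d) (R : realType)
  (P : probability T R) (r : R) : (\int[P]_w r = r)%R.
Proof.
rewrite (@Rintegral_cst _ _ _ P setT measurableT r).
by rewrite [X in fine X](probability_setT P) mulr1.
Qed.

Lemma integrable_bounded d (T : measurableType d) (R : realType)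
    (P : probability T R) (K : R) (f : T -> R) :
  measurable_fun [set: T] f -> (forall x, (`|f x| <= K)%R) ->
  P.-integrable setT (EFin \o f).
Proof.
move=> mf fK; have i1 := finite_measure_integrable_cst P 1 (@measurableT _ T).
apply: eq_integrable (integrable_boundedM i1 mf fK) => // x _.
by rewrite /= mul1r.
Qed.

Lemma dominated_small d (T : measurableType d) (R : realType)
    (nu : {measure set T -> \bar R}) (f : nat -> T -> R) (g : T -> R) (e : R) :
  (0 < e)%R -> (forall k, measurable_fun [set: T] (f k)) ->
  (forall k x, (0 <= f k x <= g x)%R) ->
  (forall x, f ^~ x @ \oo --> (0%R : R)) ->
  nu.-integrable [set: T] (EFin \o g) ->
  exists k, \int[nu]_x (f k x)%:E < e%:E.
Proof.
move=> e0 mf fg f0 ig.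
have [||||_ _ cv] := @dominated_convergence _ _ _ nu setT measurableT
  (fun k x => (f k x)%:E) (cst 0) (EFin \o g) _ _ _ ig.
- by move=> k; exact/measurable_EFinP.
- exact: measurable_cst.
- by apply: aeW => x _; apply: cvg_EFin; [exact: nearW|exact: f0].
- apply: aeW => x k _ /=; have /andP[h0 h1] := fg k x.
  by rewrite lee_fin ger0_norm.
move: cv; rewrite integral0 => /fine_cvgP[fin /cvgrPdist_lt/(_ e e0) lt].
have [K _ hK] := filterI fin lt; exists K.
have [/= fK] := hK K (leqnn K).
rewrite sub0r normrN => lK; rewrite -(fineK fK) lte_fin.
by apply: le_lt_trans lK; exact: ler_norm.
Qed.

(** * Integrals against image measures and densities *)

Section Image.
Context d1 d2 (T : measurableType d1) (Y : measurableType d2) (R : realType).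
Variables (P : {measure set T -> \bar R}) (nu : {measure set Y -> \bar R}).
Variables (phi : T -> Y) (mphi : measurable_fun setT phi).
Hypothesis imE : forall A, measurable A -> P (phi @^-1` A) = nu A.
Let mphi_mixin := isMeasurableFun.Build _ _ _ _ _ mphi.
Let mphi_pack : {mfun _ >-> _} := HB.pack phi mphi_mixin.

(** The measure [nu] is given, and only assumed to agree with the image of [P]
    on measurable sets: this is the form in which laws of random variables
    occur. *)
Lemma ge0_integral_image (g : Y -> \bar R) :
  measurable_fun [set: Y] g -> (forall y, 0 <= g y) ->
  \int[P]_w g (phi w) = \int[nu]_y g y.
Proof.
move=> mg g0; transitivity (\int[pushforward P mphi_pack]_y g y).
  by rewrite ge0_integral_pushforward.
by apply: eq_measure_integral => A mA _; rewrite -imE.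
Qed.

Lemma integrable_image (g : Y -> \bar R) : measurable_fun [set: Y] g ->
  P.-integrable setT (g \o phi) <-> nu.-integrable setT g.
Proof.
move=> mg; have mgp : measurable_fun [set: T] (g \o phi) by exact: measurableT_comp.
have E : \int[P]_w `|(g \o phi) w| = \int[nu]_y `|g y|.
  by rewrite -(@ge0_integral_image (fun y => `|g y|))//; exact: measurableT_comp.
by split=> /integrableP[_ h]; apply/integrableP; split=> //;
  [rewrite -E|rewrite E].
Qed.

Lemma integral_image (g : Y -> \bar R) : measurable_fun [set: Y] g ->
  \int[P]_w g (phi w) = \int[nu]_y g y.
Proof.
move=> mg; rewrite -[fun w => g (phi w)]/(g \o phi) integralE [RHS]integralE.
rewrite (funepos_comp g phi) (funeneg_comp g phi).
congr (_ - _).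
  by rewrite -(@ge0_integral_image g^\+)//; exact: measurable_funepos.
by rewrite -(@ge0_integral_image g^\-)//; exact: measurable_funeneg.
Qed.

End Image.

Section Law.
Context (R : realType) (d : measure_display) (T : measurableType d).
Variables (P : probability T R) (X : {RV P >-> R}).
Variable mu : probability (measurableTypeR R) R.
Hypothesis X_law : has_law X mu.

Let mX : @measurable_fun _ _ T (measurableTypeR R) setT X.
Proof. exact: (@measurable_funPT _ _ _ _ X). Qed.

Lemma integrable_law (g : R -> \bar R) : measurable_fun [set: R] g ->
  P.-integrable setT (g \o X) <-> mu.-integrable setT g.
Proof. exact: (integrable_image mX X_law). Qed.

Lemma integral_law (g : R -> \bar R) : measurable_fun [set: R] g ->
  \int[P]_w g (X w) = \int[mu]_x g x.
Proof. exact: (integral_image mX X_law). Qed.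

End Law.

Section Density.
Context d (T : measurableType d) (R : realType).
Variables (lam m : {measure set T -> \bar R}) (p : T -> R).
Hypothesis mp : measurable_fun [set: T] p.
Hypothesis p0 : forall x, (0 <= p x)%R.
Hypothesis mE : forall A, measurable A -> m A = \int[lam]_(x in A) (p x)%:E.

Import HBNNSimple.

Let mpE : measurable_fun [set: T] (EFin \o p).
Proof. exact/measurable_EFinP. Qed.

Let integral_density_nnsfun (f : {nnsfun T >-> R}) :
  \int[m]_x (f x)%:E = \int[lam]_x ((f x)%:E * (p x)%:E).
Proof.
rewrite integralT_nnsfun sintegralE.
have fE x : (f x)%:E * (p x)%:E =
    \sum_(r \in range f) (r%:E * ((\1_(f @^-1` [set r]) x)%:E * (p x)%:E)).
  rewrite fimfunE -fsumEFin// ge0_mule_fsuml//; last first.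
    by move=> r; rewrite EFinM nnfun_muleindic_ge0.
  by apply: eq_fsbigr => r _; rewrite EFinM muleA.
under [RHS]eq_integral do rewrite fE.
rewrite ge0_integral_fsum//=.
- apply: eq_fsbigr => r /set_mem[x _ <-].
  rewrite ge0_integralZl//=.
  + congr (_ * _); rewrite mE// integral_mkcond; apply: eq_integral => y _.
    by rewrite epatch_indic /= muleC.
  + apply: emeasurable_funM => //; exact/measurable_EFinP/measurable_indic.
  + by move=> y _; rewrite mule_ge0 ?lee_fin.
  + by rewrite lee_fin.
- move=> r; apply: measurable_funeM; apply: emeasurable_funM => //.
  exact/measurable_EFinP/measurable_indic.
- move=> r x _; rewrite muleA; apply: mule_ge0; last by rewrite lee_fin.
  exact: nnfun_muleindic_ge0.
Qed.

(** True by definition for indicators, hence for simple functions, hence by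
    monotone convergence. *)
Lemma ge0_integral_density (f : T -> \bar R) :
  measurable_fun [set: T] f -> (forall x, 0 <= f x) ->
  \int[m]_x f x = \int[lam]_x (f x * (p x)%:E).
Proof.
move=> mf f0; pose f_ := nnsfun_approx measurableT mf.
transitivity (limn (fun n => \int[m]_x (f_ n x)%:E)).
  rewrite -monotone_convergence//.
  - by apply: eq_integral => y _; apply/esym/cvg_lim => //;
      apply: cvg_nnsfun_approx => // *; exact: f0.
  - by move=> n; exact/measurable_EFinP/measurable_funP.
  - by move=> n y _; rewrite lee_fin.
  - by move=> y _ a b ab; rewrite lee_fin; exact/lefP/nd_nnsfun_approx.
under eq_fun do rewrite integral_density_nnsfun.
rewrite -monotone_convergence//.
- apply: eq_integral => y _; apply/cvg_lim => //.
  apply: cvgeZr => //.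
  by apply: cvg_nnsfun_approx => // *; exact: f0.
- move=> n; apply: emeasurable_funM => //.
  exact/measurable_EFinP/measurable_funP.
- by move=> n y _; rewrite mule_ge0 ?lee_fin.
- move=> y _ a b ab; rewrite lee_wpmul2r ?lee_fin//.
  exact/lefP/nd_nnsfun_approx.
Qed.

Lemma integral_density (f : T -> \bar R) : measurable_fun [set: T] f ->
  \int[m]_x f x = \int[lam]_x (f x * (p x)%:E).
Proof.
move=> mf; rewrite integralE [RHS]integralE.
congr (_ - _); rewrite ge0_integral_density//.
- apply: eq_integral => x _; rewrite !funeposE.
  have [fx0|/ltW fx0] := leP 0 (f x); first by rewrite max_l// mule_ge0 ?lee_fin.
  by rewrite mul0e max_r// mule_le0_ge0 ?lee_fin.
- exact: measurable_funepos.
- apply: eq_integral => x _; rewrite !funenegE -mulNe.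
  have [fx0|/ltW fx0] := leP 0 (- f x); first by rewrite max_l// mule_ge0 ?lee_fin.
  by rewrite mul0e max_r// mule_le0_ge0 ?lee_fin.
- exact: measurable_funeneg.
Qed.

End Density.

(** * Continuous test functions *)

Section ContinuousApproximation.
Context (R : realType).
Variables (nu : {measure set (measurableTypeR R) -> \bar R}) (w : R -> R).
Hypothesis w_ge0 : forall x, (0 <= w x)%R.
Hypothesis w_int : nu.-integrable setT (EFin \o w).

Let err (B : set R) (phi : R -> R) : \bar R :=
  \int[nu]_x (w x * `|\1_B x - phi x|)%:E.

(** The sets with this property form a sigma-algebra that contains the rays. *)
Let approximable (B : set R) := measurable B /\ forall e : R, (0 < e)%R ->
  exists phi : R -> R, [/\ continuous phi, forall x, (0 <= phi x <= 1)%R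
    & err B phi < e%:E].

Let measurable_err (B : set R) (phi : R -> R) : measurable B ->
  measurable_fun [set: R] (phi : R -> R) ->
  measurable_fun setT (fun x => (w x * `|\1_B x - phi x|)%:E).
Proof.
move=> mB mphi; apply/measurable_EFinP; apply: measurable_funM.
  by apply/measurable_EFinP; exact: measurable_int w_int.
apply: measurableT_comp => //; apply: measurable_funB => //.
Qed.

Let err_ge0 (B : set R) (phi : R -> R) x : 0 <= (w x * `|\1_B x - phi x|)%:E.
Proof. by rewrite lee_fin mulr_ge0. Qed.

Let approximable_setC B : approximable B -> approximable (~` B).
Proof.
move=> [mB aB]; split; first exact: measurableC.
move=> e /aB[phi [cphi phi01 ephi]]; exists (fun x => 1 - phi x)%R; split.
- by move=> x; apply: cvgB; [exact: cvg_cst|exact: cphi].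
- by move=> x; have /andP[h0 h1] := phi01 x; rewrite subr_ge0 h1 lerBlDr lerDl h0.
- congr (_ < _): ephi; apply: eq_integral => x _; congr (_ * _)%:E.
  rewrite !indicE in_setC -normrN; congr (`|_|%R).
  by case: (x \in B) => /=; ring.
Qed.

(** The maximum of two approximations is an approximation of the union. *)
Let approximable_setU A B : approximable A -> approximable B ->
  approximable (A `|` B).
Proof.
move=> [mA aA] [mB aB]; split; first exact: measurableU.
move=> e e0; have e2 : (0 < e / 2)%R by rewrite divr_gt0.
have [phi [cphi phi01 ephi]] := aA _ e2.
have [psi [cpsi psi01 epsi]] := aB _ e2.
have mphi := continuous_measurable_fun cphi.
have mpsi := continuous_measurable_fun cpsi.
exists (phi \max psi); split.
- by move=> x; apply: (@continuous_max R R phi psi x); [exact: cphi|exact: cpsi].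
- move=> x; have /andP[h0 h1] := phi01 x; have /andP[k0 k1] := psi01 x.
  by rewrite le_max h0 ge_max h1 k1.
apply: (@le_lt_trans _ _ (err A phi + err B psi)); last first.
  by rewrite [e]splitr EFinD lteD.
rewrite /err -ge0_integralD//; [|exact: measurable_err..].
apply: ge0_le_integral => //.
- apply: measurable_err; first exact: measurableU.
  exact: measurable_maxr.
- by apply: emeasurable_funD; exact: measurable_err.
move=> x _; rewrite -EFinD lee_fin -mulrDr ler_wpM2l//.
have /andP[h0 h1] := phi01 x; have /andP[k0 k1] := psi01 x.
rewrite !indicE in_setU; case: (x \in A); case: (x \in B) => /=;
  rewrite ?sub0r ?normrN; case: (leP (phi x) (psi x)) => hl;
  rewrite ?[`|1 - _|%R]ger0_norm ?subr_ge0 // ?ger0_norm //; lra.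
Qed.

Let approximable_ray a : approximable `]a, +oo[%classic.
Proof.
split => // e e0.
(* a ramp of slope [k] that starts at [a] *)
pose f (k : nat) (x : R) : R := (Num.min 1 (Num.max 0 (k%:R * (x - a))))%R.
have cf k : continuous (f k).
  move=> x; apply: (@continuous_min R R (cst 1%R) _ x); first exact: cvg_cst.
  apply: (@continuous_max R R (cst 0%R) _ x); first exact: cvg_cst.
  by apply: cvgM; [exact: cvg_cst|apply: cvgB; [exact: cvg_id|exact: cvg_cst]].
have f01 k x : (0 <= f k x <= 1)%R.
  by rewrite /f le_min ge_min lexx ler01/= le_max lexx.
have [|||K hK] := @dominated_small _ _ _ nu
    (fun k x => w x * `|\1_(`]a, +oo[%classic) x - f k x|)%R w e e0 _ _ _ w_int.
- move=> k; have mk := continuous_measurable_fun (cf k).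
  have mr : measurable (`]a, +oo[%classic : set R) by [].
  by have /measurable_EFinP := measurable_err mr mk.
- move=> k x; rewrite mulr_ge0//= ler_piMr//; have /andP[h0 h1] := f01 k x.
  rewrite indicE; case: (_ \in _) => /=.
    by rewrite ger0_norm ?subr_ge0// lerBlDr lerDl.
  by rewrite sub0r normrN ger0_norm.
- move=> x; apply: cvg_near_cst.
  have [xa|ax] := leP x a.
    apply: nearW => k; rewrite indicE memNset/=; last first.
      by rewrite in_itv/= andbT => /(le_lt_trans xa); rewrite ltxx.
    rewrite /f max_l; first by rewrite min_r// subr0 normr0 mulr0.
    by rewrite mulr_ge0_le0// subr_le0.
  near=> k; rewrite indicE mem_set/=; last by rewrite in_itv/= ax.
  rewrite /f min_l ?subrr ?normr0 ?mulr0//.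
  rewrite le_max; apply/orP; right.
  rewrite -ler_pdivrMr ?subr_gt0//.
  by near: k; exact: nbhs_infty_ger.
by exists (f K); split.
Unshelve. all: by end_near. Qed.

Let approximable_bigcup (F : (set R)^nat) :
  (forall k, approximable (F k)) -> approximable (\bigcup_k F k).
Proof.
move=> aF; split; first by apply: bigcupT_measurable => k; case: (aF k).
move=> e e0; have e2 : (0 < e / 2)%R by rewrite divr_gt0.
pose U k := \big[setU/set0]_(i < k) F i.
have aU k : approximable (U k).
  rewrite /U; elim: k => [|k ih].
    rewrite big_ord0 -setCT; apply: approximable_setC; split => // r r0.
    exists (cst 1%R); split.
    - by move=> x; exact: cvg_cst.
    - by move=> x /=; rewrite ler01 lexx.
    - rewrite /err integral0_eq ?lte_fin// => x _.
      by rewrite indicE in_setT subrr normr0 mulr0.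
  by rewrite big_ord_recr; exact: approximable_setU.
have mU k : measurable (U k) by case: (aU k).
have mF : measurable (\bigcup_k F k).
  by apply: bigcupT_measurable => k; case: (aF k).
have [|||K hK] := @dominated_small _ _ _ nu
    (fun k x => w x * `|\1_(\bigcup_k F k) x - \1_(U k) x|)%R w (e / 2) e2 _ _ _ w_int.
- move=> k; have mk : measurable_fun [set: R] (\1_(U k) : R -> R).
    exact: measurable_indic.
  by have /measurable_EFinP := measurable_err mF mk.
- move=> k x; rewrite mulr_ge0//= ler_piMr// !indicE.
  by case: (_ \in _); case: (_ \in _);
    rewrite ?subrr ?subr0 ?sub0r ?normrN ?normr0 ?normr1.
- move=> x; apply: cvg_near_cst.
  have [[N _ FNx]|nFx] := pselect ((\bigcup_k F k) x).
    near=> k; rewrite !indicE !mem_set ?subrr ?normr0 ?mulr0//; last by exists N.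
    rewrite /U -bigcup_mkord; exists N => //=.
    by near: k; exact: nbhs_infty_gt.
  apply: nearW => k; rewrite !indicE !memNset ?subrr ?normr0 ?mulr0//.
  rewrite /U -bigcup_mkord => -[i _ Fix]; apply: nFx; by exists i.
have [_ /(_ _ e2)[phi [cphi phi01 ephi]]] := aU K.
exists phi; split => //.
have mphi := continuous_measurable_fun cphi.
apply: (@le_lt_trans _ _ (\int[nu]_x (w x * `|\1_(\bigcup_k F k) x - \1_(U K) x|)%:E
  + err (U K) phi)); last by rewrite [e]splitr EFinD lteD.
rewrite /err -ge0_integralD//; [|exact: measurable_err..].
apply: ge0_le_integral => //.
- exact: measurable_err.
- by apply: emeasurable_funD; exact: measurable_err.
move=> x _; rewrite -EFinD lee_fin -mulrDr ler_wpM2l//.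
by rewrite -[X in (`|X| <= _)%R](subrKA (\1_(U K) x)) ler_normD.
Unshelve. all: by end_near. Qed.

(** The weight [w] allows the approximation to be used both for total
    variation ([w = 1]) and to test whether an integrable function is null
    ([w] its absolute value). *)
Lemma continuous_approximation (B : set R) : measurable B ->
  forall e : R, (0 < e)%R -> exists phi : R -> R,
    [/\ continuous phi, forall x, (0 <= phi x <= 1)%R &
        \int[nu]_x (w x * `|\1_B x - phi x|)%:E < e%:E].
Proof.
move=> mB; have sB : (@ocitv R).-sigma.-measurable B := mB.
rewrite RGenOInfty.measurableE in sB.
suff [] : approximable B by [].
apply: sB; split.
  split.
  - rewrite -setCT; apply: approximable_setC; split => // r r0.
    exists (cst 1%R); split.
    + by move=> x; exact: cvg_cst.
    + by move=> x /=; rewrite ler01 lexx.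
    + rewrite /err integral0_eq ?lte_fin// => x _.
      by rewrite indicE in_setT subrr normr0 mulr0.
  - by move=> A aA; rewrite setTD; exact: approximable_setC.
  - exact: approximable_bigcup.
by move=> _ [a ->]; exact: approximable_ray.
Qed.

End ContinuousApproximation.

(** Borel sets cannot separate two laws better than continuous functions with
    values in [[0, 1]] do. *)
Lemma probability_dist_continuous (R : realType)
    (nu1 nu2 : probability (measurableTypeR R) R) (K : R) :
  (forall h : R -> R, continuous h -> (forall x, (0 <= h x <= 1)%R) ->
    (`|\int[nu1]_x h x - \int[nu2]_x h x| <= K)%R) ->
  forall B, measurable B -> `|nu1 B - nu2 B| <= K%:E.
Proof.
move=> hK B mB.
have nuE (nu : probability (measurableTypeR R) R) :
    nu B = (\int[nu]_x (\1_B x : R))%R%:E.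
  rewrite /Rintegral integral_indic// setIT fineK//.
  exact: (fin_num_measure nu).
rewrite !nuE -EFinB abse_EFin lee_fin.
apply/ler_addgt0Pr => e e0.
(* one function has to approximate the indicator of [B] for both laws *)
pose nu : {measure set (measurableTypeR R) -> \bar R} := measure_add nu1 nu2.
have w_int : nu.-integrable setT (EFin \o (cst 1%R : R -> R)).
  apply/integrableP; split; first exact/measurable_EFinP.
  rewrite ge0_integral_measure_add//; last first.
    by apply: measurableT_comp => //; exact/measurable_EFinP.
  by rewrite /= normr1 !integral_cst// !mul1e -ge0_fin_numE ?adde_ge0//
    fin_numD !fin_num_measure.
have [//|phi [cphi phi01 ephi]] :=
  @continuous_approximation R nu (cst 1%R) _ w_int B mB e e0.
have mphi : measurable_fun [set: R] phi by exact: continuous_measurable_fun.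
have iphi (la : probability (measurableTypeR R) R) : la.-integrable setT (EFin \o phi).
  apply: (integrable_bounded _ (K := 1%R)) => // x.
  by have /andP[h0 h1] := phi01 x; rewrite ger0_norm.
have ind (la : probability (measurableTypeR R) R) :
    la.-integrable setT (EFin \o (\1_B : R -> R)).
  exact: integrable_indic.
have idiff (la : probability (measurableTypeR R) R) :
    la.-integrable setT (EFin \o (fun x => `|\1_B x - phi x|%R)).
  exact: (integrable_norm (integrable_Rsub (ind la) (iphi la))).
have dist (la : probability (measurableTypeR R) R) :
    (`|\int[la]_x (\1_B x : R) - \int[la]_x phi x| <= \int[la]_x `|\1_B x - phi x|)%R.
  rewrite -RintegralB//; [|exact: ind|exact: iphi].
  exact: (le_normr_Rintegral measurableT (integrable_Rsub (ind la) (iphi la))).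
have err (la : probability (measurableTypeR R) R) :
    \int[la]_x (cst 1%R x * `|\1_B x - phi x|)%:E =
    (\int[la]_x `|\1_B x - phi x|)%R%:E.
  rewrite /Rintegral fineK; last exact: (integrable_fin_num _ (idiff la)).
  by apply: eq_integral => x _; rewrite mul1r.
move: ephi; rewrite ge0_integral_measure_add//; last 2 first.
- by move=> x _; rewrite lee_fin mul1r.
- apply: (eq_measurable_fun (EFin \o (fun x => `|\1_B x - phi x|%R))).
    by move=> x _; rewrite /= mul1r.
  exact: measurable_int (idiff nu1).
rewrite !err -EFinD lte_fin => ephi.
have := hK _ cphi phi01; have := dist nu1; have := dist nu2.
rewrite !ler_norml => /andP[a1 a2] /andP[b1 b2] /andP[c1 c2].
by apply/andP; split; lra.
Qed.

(** * Independence of one variable from the others *)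

Section Independence.
Context (R : realType) (d : measure_display) (T : measurableType d).
Variables (P : probability T R) (n : nat) (X : 'I_n -> {RV P >-> R}).
Hypothesis X_indep : independent_RVs X.
Variable j : 'I_n.

(** The pi-system that generates the sigma-algebra of the variables other than
    [X j]; a function of these variables is handled as a function measurable
    for the generated sigma-algebra, so that no product space is needed. *)
Definition other_cylinders : set (set T) :=
  [set E | exists2 B : 'I_n -> set R, (forall i, measurable (B i)) &
    E = \bigcap_(i in [set i | i != j]) (X i @^-1` B i)].

Lemma measurable_other_cylinders : other_cylinders `<=` measurable.
Proof.
move=> _ [B mB ->]; apply: fin_bigcap_measurable => //= i _.
exact: measurable_funPTI.
Qed.

Lemma measurable_other i : i != j ->
  measurable_fun [set: g_sigma_algebraType other_cylinders] (X i).
Proof.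
move=> ij _ B mB; rewrite setTI; apply: sub_sigma_algebra.
exists (fun k => if k == i then B else setT).
  by move=> k; case: ifP.
apply/seteqP; split => [x Bx k /= _|x /(_ i ij)]; last by rewrite /= eqxx.
by case: eqP => // ->.
Qed.

Lemma measurable_other_sigma (E : set T) :
  <<s other_cylinders >> E -> measurable E.
Proof.
apply: smallest_sub => //; first exact: sigma_algebra_measurable.
exact: measurable_other_cylinders.
Qed.

(** For fixed [A], both sides are finite measures in the second event, and they
    agree on the pi-system of cylinders. *)
Lemma other_independent (Y : T -> R) :
  measurable_fun [set: g_sigma_algebraType other_cylinders] Y ->
  forall A B, measurable A -> measurable B ->
  P (X j @^-1` A `&` Y @^-1` B) = P (X j @^-1` A) * P (Y @^-1` B).
Proof.
move=> mY A B mA mB.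
have mXA : measurable (X j @^-1` A) by exact: measurable_funPTI.
pose r : {nonneg R} := NngNum (fine_ge0 (measure_ge0 P (X j @^-1` A))).
have rE : (r%:num)%:E = P (X j @^-1` A).
  by rewrite /= fineK// fin_num_measure.
have -> : P (X j @^-1` A) * P (Y @^-1` B) = mscale r P (Y @^-1` B).
  by rewrite /mscale/= -rE.
have -> : P (X j @^-1` A `&` Y @^-1` B) = mrestr P mXA (Y @^-1` B).
  by rewrite /mrestr/= setIC.
apply: (@g_sigma_algebra_measure_unique _ _ _ other_cylinders
  measurable_other_cylinders (fun=> setT)).
- move=> _; exists (fun=> setT) => //.
  by apply/seteqP; split.
- by apply/seteqP; split => // x _; exists 0%N.
- move=> _ _ [B1 mB1 ->] [B2 mB2 ->].
  exists (fun i => B1 i `&` B2 i); first by move=> i; exact: measurableI.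
  apply/seteqP; split.
    by move=> x [h1 h2] i ij; split; [exact: h1|exact: h2].
  by move=> x h; split => i ij; have [] := h i ij.
- move=> _ [C mC ->].
  rewrite /mrestr/= /mscale/= -/(r%:num) rE.
  pose D i := if i == j then A else C i.
  have mD i : measurable (D i) by rewrite /D; case: ifP.
  have e1 : \bigcap_(k in [set` [set: 'I_n]%SET]) (X k @^-1` D k) =
    (\bigcap_(k in [set i | i != j]) X k @^-1` C k) `&` (X j @^-1` A).
    apply/seteqP; split => [x h|x [h hj] k _].
      split; last by have := h j; rewrite /D eqxx; apply; rewrite /= inE.
      by move=> k kj; have := h k; rewrite /D (negbTE kj); apply; rewrite /= inE.
    by rewrite /D; case: eqP => [->//|/eqP kj]; exact: h.
  have e2 : \bigcap_(k in [set` (~: [set j])%SET]) (X k @^-1` D k) =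
    \bigcap_(k in [set i | i != j]) X k @^-1` C k.
    apply/seteqP; split => x h k /= kj; have := h k.
      by rewrite /D (negbTE kj) /= !inE; exact.
    by move: kj; rewrite /= !inE /D => kj; rewrite (negbTE kj); exact.
  transitivity (P ((\bigcap_(k in [set i | i != j]) X k @^-1` C k) `&`
                   (X j @^-1` A))); first by [].
  rewrite -e1 X_indep// -e2 X_indep// (bigD1 j)/= ?inE//.
  rewrite {1}/D eqxx; congr (_ * _).
  by apply: eq_bigl => i; rewrite !inE.
- by move=> _; rewrite ltey_eq fin_num_measure.
- have := mY measurableT _ mB; rewrite setTI; exact.
Qed.

Lemma joint_law_other (mu nu : probability (measurableTypeR R) R) (Y : T -> R) :
  measurable_fun [set: g_sigma_algebraType other_cylinders] Y ->
  (forall A, measurable A -> P (X j @^-1` A) = mu A) ->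
  (forall A, measurable A -> P (Y @^-1` A) = nu A) ->
  forall C, measurable C -> P ((fun w => (X j w, Y w)) @^-1` C) = (mu \x nu) C.
Proof.
move=> mY Xmu Ynu C mC.
have mYT : measurable_fun [set: T] Y.
  by move=> _ B mB; apply: measurable_other_sigma; exact: mY.
have mXY : @measurable_fun _ _ T (measurableTypeR R * measurableTypeR R)%type
    [set: T] (fun w => (X j w, Y w)).
  apply: (@measurable_fun_pair _ _ _ T (measurableTypeR R) (measurableTypeR R)).
    exact: (@measurable_funPT _ _ _ _ (X j)).
  exact: mYT.
pose XY : {mfun T >-> (measurableTypeR R * measurableTypeR R)%type} :=
  HB.pack (fun w => (X j w, Y w)) (isMeasurableFun.Build _ _ _ _ _ mXY).
rewrite (@product_measure_unique _ _ _ _ _ mu nu (pushforward P XY))// => A B mA mB.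
transitivity (P (X j @^-1` A `&` Y @^-1` B)); first by [].
rewrite other_independent//; congr (_ * _); [exact: Xmu|exact: Ynu].
Qed.

(** Fubini's theorem for the product law of [X j] and [Y]: to compare two
    expectations it is enough to compare them with [Y] frozen. *)
Lemma integral_other_eq (mu : probability (measurableTypeR R) R) (Y : T -> R)
    (G H : measurableTypeR R * measurableTypeR R -> R) :
  measurable_fun [set: g_sigma_algebraType other_cylinders] Y ->
  has_law (X j) mu ->
  measurable_fun [set: measurableTypeR R * measurableTypeR R] G ->
  measurable_fun [set: measurableTypeR R * measurableTypeR R] H ->
  P.-integrable setT (EFin \o (fun w => G (X j w, Y w))) ->
  P.-integrable setT (EFin \o (fun w => H (X j w, Y w))) ->
  (forall y, \int[mu]_x (G (x, y))%:E = \int[mu]_x (H (x, y))%:E) ->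
  \int[P]_w (G (X j w, Y w))%:E = \int[P]_w (H (X j w, Y w))%:E.
Proof.
move=> mY Xmu mG mH iG iH GH.
have mYT : @measurable_fun _ _ T (measurableTypeR R) [set: T] Y.
  by move=> _ B mB; apply: measurable_other_sigma; exact: mY.
have mX : @measurable_fun _ _ T (measurableTypeR R) [set: T] (X j).
  exact: (@measurable_funPT _ _ _ _ (X j)).
have mXY := measurable_fun_pair mX mYT.
pose Y' : {mfun T >-> measurableTypeR R} :=
  HB.pack Y (isMeasurableFun.Build _ _ _ _ _ mYT).
pose nu : probability (measurableTypeR R) R := distribution P Y'.
have J := @joint_law_other mu nu Y mY Xmu (fun A _ => erefl).
have E (k : measurableTypeR R * measurableTypeR R -> R) :
    measurable_fun [set: measurableTypeR R * measurableTypeR R] k ->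
    P.-integrable setT (EFin \o (fun w => k (X j w, Y w))) ->
    \int[P]_w (k (X j w, Y w))%:E = \int[nu]_y \int[mu]_x (k (x, y))%:E.
  move=> mk ik; have mk' : measurable_fun [set: measurableTypeR R * measurableTypeR R]
    (EFin \o k) by exact/measurable_EFinP.
  rewrite (integral_image mXY J mk').
  have ik' := (integrable_image mXY J mk').1 ik.
  exact/esym/(integral21_prod_meas1 ik').
by rewrite E// E//; apply: eq_integral => y _; exact: GH.
Qed.
End Independence.

(** * The Stein equation *)

Section SteinEquation.
Local Open Scope ring_scope.
Context (R : realType).
Notation leb := (@lebesgue_measure R).
Notation gauss := (normal_pdf (0 : R) 1).
Implicit Types x : R.

Lemma gaussE x : gauss x = normal_peak 1 * expR (- (x ^+ 2 / 2)).
Proof.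
rewrite normal_pdfE ?oner_eq0// /normal_fun subr0 expr1n.
by rewrite mulNr.
Qed.

Lemma gauss_gt0 x : 0 < gauss x.
Proof. by rewrite gaussE mulr_gt0 ?expR_gt0// normal_peak_gt0 ?oner_eq0. Qed.

Lemma gaussN x : gauss (- x) = gauss x.
Proof. by rewrite !gaussE sqrrN. Qed.

Lemma continuous_gauss : continuous gauss.
Proof. by apply: continuous_normal_pdf; rewrite oner_eq0. Qed.

Lemma is_derive_gauss x : is_derive x 1 gauss (- (x * gauss x)).
Proof.
have -> : gauss = (fun t => normal_peak 1 * expR (- (t ^+ 2 / 2))).
  by apply/funext => t; exact: gaussE.
apply: is_derive_eq.
by rewrite /GRing.scale/= mulr0; field.
Qed.

Lemma cvg_gauss : gauss x @[x --> +oo] --> (0 : R).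
Proof.
have -> : gauss = (fun t => normal_peak 1 * expR (- (t ^+ 2 / 2))).
  by apply/funext => t; exact: gaussE.
rewrite -[X in _ --> X](mulr0 (normal_peak 1 : R)).
apply: cvgM; first exact: cvg_cst.
apply: (cvg_comp (fun x => x ^+ 2 / 2) (fun x => expR (- x))).
  apply: gt0_cvgMly; first by rewrite invr_gt0.
  exact: cvgr_expr2.
exact: cvgr_expR.
Qed.

Lemma continuous_id_gauss : continuous (fun t : R => t * gauss t).
Proof. by move=> x; apply: cvgM; [exact: cvg_id|exact: continuous_gauss]. Qed.

Lemma integral_id_gauss x : 0 <= x ->
  (\int[leb]_(t in `[x, +oo[) (t * gauss t)%:E = (gauss x)%:E)%E.
Proof.
move=> x0.
rewrite (@ge0_continuous_FTC2y _ _ (fun t => - gauss t) x 0).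
- by rewrite add0e EFinN oppeK.
- by move=> t xt; apply: mulr_ge0; [exact: le_trans x0 xt|exact/ltW/gauss_gt0].
- by apply: continuous_subspaceT; exact: continuous_id_gauss.
- by rewrite -[X in _ --> X]oppr0; apply: (@cvgN _ R^o); exact: cvg_gauss.
- move=> t _; apply: derivableN.
  by have [] := is_derive_gauss t.
- by apply: cvg_at_right_filter; apply: (@cvgN _ R^o); exact: continuous_gauss.
- move=> t _; rewrite derive1E deriveN; last by have [] := is_derive_gauss t.
  by have [_ ->] := is_derive_gauss t; rewrite opprK.
Qed.

Lemma integrable_gauss : leb.-integrable setT (EFin \o gauss).
Proof. exact: integrable_normal_pdf. Qed.

(** Mills' bound: the Gaussian mass of a tail, times its endpoint, is at most
    the integral of [t * gauss t] over this tail, and that is the density. *)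
Lemma mills_right x : 0 <= x ->
  x * \int[leb]_(t in `[x, +oo[) gauss t <= gauss x.
Proof.
move=> x0; have iG : leb.-integrable `[x, +oo[ (EFin \o gauss).
  by apply: integrableS integrable_gauss.
rewrite -RintegralZl//.
rewrite -[leRHS]/(fine (gauss x)%:E) -integral_id_gauss//.
have iG2 : leb.-integrable `[x, +oo[ (EFin \o (fun t => t * gauss t)).
  apply/integrableP; split.
    apply/measurable_EFinP; apply: measurable_funTS.
    by apply: continuous_measurable_fun; exact: continuous_id_gauss.
  under eq_integral.
    move=> t; rewrite inE/= in_itv/= andbT => xt.
    rewrite ger0_norm ?mulr_ge0 ?(le_trans x0 xt) ?(ltW (gauss_gt0 _))//.
    over.
  by rewrite integral_id_gauss// ltry.
apply: le_Rintegral => //.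
  exact: (integrableZl _ x iG).
move=> t /=; rewrite in_itv/= andbT => xt.
by rewrite ler_wpM2r// ltW// gauss_gt0.
Qed.

Lemma mills_left x : x <= 0 ->
  - x * \int[leb]_(t in `]-oo, x]) gauss t <= gauss x.
Proof.
move=> x0; have := @mills_right (- x); rewrite oppr_ge0 gaussN => /(_ x0).
congr (_ * _ <= _); rewrite /Rintegral -[x in RHS]opprK.
rewrite ge0_integration_by_substitutionNy.
- by congr fine; apply: eq_integral => t _; rewrite /= gaussN.
- by apply: continuous_subspaceT; exact: continuous_gauss.
- by move=> t _; rewrite ltW// gauss_gt0.
Qed.

Section Solution.
Variable h : R -> R.
Hypothesis ch : continuous h.
Hypothesis h01 : forall x, 0 <= h x <= 1.

Let N := \int[leb]_t (h t * gauss t).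
Let g t := (h t - N) * gauss t.
Let F x := \int[leb]_(t in `]-oo, x]) g t.
Let f x := F x * (gauss x)^-1.

Let mh : measurable_fun [set: R] h.
Proof. exact: continuous_measurable_fun. Qed.

Let integrable_weighted (k : R -> R) : measurable_fun [set: R] k ->
  (forall t, `|k t| <= 1) ->
  leb.-integrable setT (EFin \o (fun t => k t * gauss t)).
Proof.
move=> mk k1; apply: (le_integrable _ _ _ integrable_gauss) => //.
  apply/measurable_EFinP; apply: measurable_funM => //.
  exact: measurable_normal_pdf.
move=> t _ /=; rewrite lee_fin normrM ler_piMl//.
Qed.

Let norm_h t : `|h t| <= 1.
Proof. by have /andP[h0 h1] := h01 t; rewrite ger0_norm. Qed.

Let integral_gauss : \int[leb]_t gauss t = 1.
Proof. by rewrite /Rintegral integral_normal_pdf. Qed.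

Let N01 : 0 <= N <= 1.
Proof.
apply/andP; split.
  apply: Rintegral_ge0 => t _; have /andP[h0 h1] := h01 t.
  by rewrite mulr_ge0// ltW// gauss_gt0.
rewrite -integral_gauss; apply: le_Rintegral => //.
- exact: integrable_weighted.
- exact: integrable_gauss.
- by move=> t _; have /andP[h0 h1] := h01 t; rewrite ler_piMl// ltW// gauss_gt0.
Qed.

Let norm_hN t : `|h t - N| <= 1.
Proof.
have /andP[h0 h1] := h01 t; have /andP[N0 N1] := N01.
by rewrite ler_norml; apply/andP; split; lra.
Qed.

Let integrable_g : leb.-integrable setT (EFin \o g).
Proof.
apply: integrable_weighted => //.
by apply: measurable_funB => //; exact: measurable_cst.
Qed.

Let integral_g : \int[leb]_t g t = 0.
Proof.
transitivity (\int[leb]_t (h t * gauss t - N * gauss t)).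
  by apply: eq_Rintegral => t _; rewrite /g mulrBl.
rewrite RintegralB//; last 2 first.
- exact: integrable_weighted.
- exact: (integrableZl _ N integrable_gauss).
by rewrite RintegralZl ?integral_gauss ?mulr1 ?subrr//; exact: integrable_gauss.
Qed.

Let cg : continuous g.
Proof.
move=> x; apply: cvgM; last exact: continuous_gauss.
by apply: cvgB; [exact: ch|exact: cvg_cst].
Qed.

Let is_derive_F x : is_derive x 1 F (g x).
Proof.
exact: is_derive_integralNy.
Qed.

Let is_derive_f x : is_derive x 1 f (x * f x + (h x - N)).
Proof.
have g0 := lt0r_neq0 (gauss_gt0 x).
have dV : is_derive x 1 (fun y => (gauss y)^-1) (- gauss x ^- 2 *: - (x * gauss x)).
  by apply: is_deriveV => //; exact: is_derive_gauss.
apply: (@is_derive_eq _ _ _ _ _ _ _ _ (is_deriveM (is_derive_F x) dV)).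
by rewrite /GRing.scale/= /f /g; field.
Qed.

Let norm_int_g (D : set (measurableTypeR R)) : measurable D ->
  `|\int[leb]_(t in D) g t| <= \int[leb]_(t in D) gauss t.
Proof.
move=> mD; have iD : leb.-integrable D (EFin \o g).
  by apply: integrableS integrable_g.
apply: (le_trans (le_normr_Rintegral mD iD)).
apply: le_Rintegral => //.
- exact: integrable_norm.
- by apply: integrableS integrable_gauss.
- move=> t _; rewrite normrM [`|gauss t|]ger0_norm ?ler_piMl//;
  exact/ltW/gauss_gt0.
Qed.

(** [g] has integral 0, so [F] can be computed from either tail; each half-line
    uses the tail that Mills' bound controls. *)
Let F_right x : F x = - \int[leb]_(t in `]x, +oo[) g t.
Proof.
apply/eqP; rewrite -addr_eq0 -integral_g; apply/eqP.
rewrite -(itv_setU_setT false x) Rintegral_setU//.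
- by rewrite itv_setU_setT; exact: integrable_g.
- apply/disj_setPS => t [] /=; rewrite !in_itv/= andbT.
  by move=> /le_lt_trans h1 /h1; rewrite ltxx.
Qed.

Let norm_xf x : `|x * f x| <= 1.
Proof.
rewrite /f mulrA normrM normfV [`|gauss x|]gtr0_norm ?gauss_gt0//.
rewrite ler_pdivrMr ?gauss_gt0// mul1r normrM.
have [x0|/ltW x0] := leP 0 x.
  rewrite ger0_norm// F_right normrN Rintegral_itv_obnd_cbnd; last first.
    by apply: integrableS integrable_g.
  by apply: le_trans (mills_right x0); rewrite ler_wpM2l// norm_int_g.
rewrite ler0_norm//; apply: le_trans (mills_left x0).
by rewrite ler_wpM2l ?oppr_ge0// norm_int_g.
Qed.

(** [f' x] is the sum of [x * f x] and [h x - N], each at most 1 in absolute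
    value. *)
Lemma stein_solution : exists f : R -> R,
  [/\ forall x, derivable f x 1, continuous (derive1 f),
      forall x, `|derive1 f x| <= 2, exists K, forall x, `|f x| <= K &
      forall x, derive1 f x - x * f x = h x - \int[leb]_t (h t * gauss t)].
Proof.
have f'E x : derive1 f x = x * f x + (h x - N).
  by rewrite derive1E; have [_ ->] := is_derive_f x.
exists f; split.
- by move=> x; have [] := is_derive_f x.
- have -> : derive1 f = fun x => x * f x + (h x - N) by apply/funext.
  move=> x; apply: cvgD; last by apply: cvgB; [exact: ch|exact: cvg_cst].
  apply: cvgM; first exact: cvg_id.
  apply: differentiable_continuous; apply/derivable1_diffP.
  by have [] := is_derive_f x.
- move=> x; rewrite f'E; apply: (le_trans (ler_normD _ _)).
  by rewrite -[2]/(1 + 1) lerD.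
- (* [`|x * f x| <= 1] bounds [f] off the compact interval [[-1, 1]] *)
  have cf : {within `[-1, 1], continuous (fun t => `|f t|)}.
    apply: continuous_subspaceT => x; apply: cvg_norm.
    apply: differentiable_continuous; apply/derivable1_diffP.
    by have [] := is_derive_f x.
  have [c _ fc] := EVT_max (le_trans (lerN10 _) ler01 : (-1 <= 1 :> R)) cf.
  exists (Num.max `|f c| 1) => x; rewrite le_max.
  have [x1|x1] := leP `|x| 1.
    by rewrite fc// in_itv/= -ler_norml.
  apply/orP; right; apply: le_trans (norm_xf x).
  by rewrite [leRHS]normrM ler_peMl// ltW.
- by move=> x; rewrite f'E addrC addKr.
Qed.

End Solution.

End SteinEquation.

(** * The Stein kernel of a law *)

(** The Stein identity depends on the law of the variable only. *)
Definition law_stein_kernel (R : realType)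
    (mu : probability (measurableTypeR R) R) (m : R) (tau : R -> R) : Prop :=
  measurable_fun [set: R] tau /\
  forall f : R -> R,
    (forall x, derivable f x 1%R) ->
    continuous (derive1 f) ->
    (exists M : R, forall x, (`|derive1 f x| <= M)%R) ->
    [/\ mu.-integrable setT (EFin \o (fun x => tau x * derive1 f x)%R),
        mu.-integrable setT (EFin \o (fun x => (x - m) * f x)%R)
      & \int[mu]_x (tau x * derive1 f x)%:E = \int[mu]_x ((x - m) * f x)%:E].

Section LawSteinKernel.
Local Open Scope ring_scope.
Context (R : realType) (mu : probability (measurableTypeR R) R).
Variables (m : R) (tau : R -> R).
Hypothesis tau_kernel : law_stein_kernel mu m tau.

Lemma law_stein_kernel_integrable : mu.-integrable setT (EFin \o tau).
Proof.
have [_ /(_ id)[]] := tau_kernel; rewrite ?derive1_id.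
- by move=> x; exact: derivable_id.
- by move=> x; exact: cvg_cst.
- by exists 1 => x; rewrite normr1.
by move=> + _ _; apply: eq_integrable => // x _; rewrite /= mulr1.
Qed.

(** For a square-integrable law the right-hand side is the variance. *)
Lemma law_stein_kernel_mean : \int[mu]_x tau x = \int[mu]_x ((x - m) * x).
Proof.
have [_ /(_ id)[]] := tau_kernel; rewrite ?derive1_id.
- by move=> x; exact: derivable_id.
- by move=> x; exact: cvg_cst.
- by exists 1 => x; rewrite normr1.
move=> _ _ e; rewrite /Rintegral -e; congr fine.
by apply: eq_integral => x _; rewrite /= mulr1.
Qed.

Lemma law_stein_kernel_centered :
  mu.-integrable setT (EFin \o (fun x => x - m)).
Proof.
have d0 : derive1 (cst 1 : R -> R) = cst 0.
  by apply/funext => x; rewrite derive1E derive_cst.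
have [_ /(_ (cst 1 : R -> R))[]] := tau_kernel; rewrite ?d0.
- by move=> x; exact: derivable_cst.
- by move=> x; exact: cvg_cst.
- by exists 0 => x; rewrite normr0.
by move=> _ + _; apply: eq_integrable => // x _; rewrite /= mulr1.
Qed.

End LawSteinKernel.

(** Only [phi * gs] with [phi] continuous is tested, where [gs] is the Gaussian
    density; Borel sets then follow by approximation. *)
Lemma law_stein_kernel_unique (R : realType)
    (mu : probability (measurableTypeR R) R)
    (m : R) (tau tau' : R -> R) :
  law_stein_kernel mu m tau -> law_stein_kernel mu m tau' ->
  {ae mu, forall x, tau x = tau' x}.
Proof.
move=> kt kt'; have [mt Ht] := kt; have [mt' Ht'] := kt'.
(* the weight makes test functions integrable, hence derivatives; it cancels
   at the end because it is positive *)
pose gs := normal_pdf (0 : R) 1.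
have mgs : measurable_fun [set: R] gs by exact: measurable_normal_pdf.
have gs0 x : (0 < gs x)%R by exact: gauss_gt0.
have gsK x : (`|gs x| <= normal_peak (1 : R))%R.
  by rewrite gtr0_norm// normal_pdf_ub// oner_eq0.
pose D x := ((tau x - tau' x) * gs x)%R.
have iD : mu.-integrable setT (EFin \o D).
  apply: (integrable_boundedM (K := normal_peak 1)) => //.
  by apply: integrable_Rsub;
    [exact: law_stein_kernel_integrable kt|exact: law_stein_kernel_integrable kt'].
have mD : measurable_fun [set: R] D by apply/measurable_EFinP; exact: measurable_int iD.
have test (phi : R -> R) : continuous phi -> (forall x, (0 <= phi x <= 1)%R) ->
    (\int[mu]_x (D x * phi x) = 0)%R.
  move=> cphi phi01; pose k t := (phi t * gs t)%R.
  have ck : continuous k.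
    by move=> x; apply: cvgM; [exact: cphi|exact: continuous_gauss].
  have kK x : (`|k x| <= normal_peak (1 : R))%R.
    rewrite normrM; have /andP[h0 h1] := phi01 x.
    rewrite ger0_norm//; apply: le_trans (gsK x).
    by rewrite ler_piMl.
  have ik : (@lebesgue_measure R).-integrable setT (EFin \o k).
    have mphi : measurable_fun [set: R] phi by exact: continuous_measurable_fun.
    have phi1 x : (`|phi x| <= 1)%R.
      by have /andP[h0 h1] := phi01 x; rewrite ger0_norm.
    apply: eq_integrable (integrable_boundedM (integrable_gauss R) mphi phi1) => //.
    by move=> x _; rewrite /= mulrC.
  pose F x := (\int[lebesgue_measure]_(t in `]-oo, x]) k t)%R.
  have dF (x : R) : is_derive x 1%R F (k x) by exact: is_derive_integralNy.
  have F' : derive1 F = k.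
    by apply/funext => x; rewrite derive1E; have [_ ->] := dF x.
  have dF1 (x : R) : derivable F x 1%R by have [] := dF x.
  have cF' : continuous (derive1 F) by rewrite F'.
  have bF' : exists M : R, forall x, (`|derive1 F x| <= M)%R.
    by exists (normal_peak 1); rewrite F'.
  have [i1 _ e1] := Ht F dF1 cF' bF'.
  have [i2 _ e2] := Ht' F dF1 cF' bF'.
  transitivity (\int[mu]_x (tau x * derive1 F x - tau' x * derive1 F x))%R.
    by apply: eq_Rintegral => x _; rewrite F' /D /k -mulrBl mulrAC mulrA.
  by rewrite RintegralB// /Rintegral e1 e2 subrr.
have w_int : mu.-integrable setT (EFin \o (fun x => `|D x|%R)) by exact: integrable_norm.
have int0 (B : set (measurableTypeR R)) : measurable B -> (\int[mu]_(x in B) D x = 0)%R.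
  move=> mB; apply/eqP; rewrite -normr_le0; apply/ler_addgt0Pr => e e0.
  have w0 x : (0 <= `|D x|)%R by [].
  have [phi [cphi phi01 ephi]] := continuous_approximation w0 w_int mB e0.
  have mphi : measurable_fun [set: R] phi by exact: continuous_measurable_fun.
  have iphi : mu.-integrable setT (EFin \o (fun x => D x * phi x)%R).
    apply: (integrable_boundedM (K := 1%R)) => // x.
    by have /andP[h0 h1] := phi01 x; rewrite ger0_norm.
  have iB : mu.-integrable setT (EFin \o (fun x => D x * \1_B x)%R).
    apply: (integrable_boundedM (K := 1%R)) => // x.
    by rewrite indicE ger0_norm; case: (_ \in _).
  have -> : (\int[mu]_(x in B) D x = \int[mu]_x (D x * \1_B x - D x * phi x))%R.
    rewrite RintegralB// (test phi)// subr0 Rintegral_mkcond.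
    by apply: eq_Rintegral => x _; rewrite patchE indicE; case: ifP; rewrite ?mulr1 ?mulr0.
  rewrite add0r -lee_fin; apply: le_trans (ltW ephi).
  have iBphi := integrable_Rsub iB iphi.
  rewrite EFin_normr_Rintegral//; apply: (le_trans (le_abse_integral _ _ _)) => //.
    exact: measurable_int iBphi.
  apply: ge0_le_integral => //.
  - by apply: measurableT_comp => //; exact: measurable_int iBphi.
  - apply/measurable_EFinP; apply: measurable_funM; first exact: measurableT_comp.
    by apply: measurableT_comp => //; exact: measurable_funB.
  - by move=> x _; rewrite lee_fin -mulrBr normrM.
have : ae_eq mu setT (cst 0) (EFin \o D).
  apply: integral_ae_eq => //; [exact: integrable0|exact: measurable_int iD|].
  move=> B _ mB; transitivity ((\int[mu]_(x in B) D x)%R%:E).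
    by rewrite int0// integral0.
  rewrite /Rintegral fineK//.
  by apply: integrable_fin_num => //; exact: (integrableS measurableT).
apply: filterS => x /(_ I) [] /esym D0.
have /eqP : D x = 0%R by [].
by rewrite /D mulf_eq0 (gt_eqF (gs0 x)) orbF subr_eq0 => /eqP.
Qed.

Section Existence.
Local Open Scope ring_scope.
Context (R : realType) (mu : probability (measurableTypeR R) R) (m : R).
Notation leb := (@lebesgue_measure R).
Hypothesis i1 : mu.-integrable setT (EFin \o (fun x => x - m)).
Hypothesis i2 : mu.-integrable setT (EFin \o (fun x => (x - m) ^+ 2)).
Hypothesis centered : \int[mu]_x (x - m) = 0.

(** [x] lies between [m] and [y]. The half-open ends make the section at [y]
    an interval [[m, y[] or [[y, m[], and the section at [x] the ray
    [y > x] or [y <= x]. *)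
Let between : set (measurableTypeR R * measurableTypeR R) :=
  [set z | m <= z.1 < z.2] `|` [set z | z.2 <= z.1 < m].

Let k (z : measurableTypeR R * measurableTypeR R) : R :=
  `|z.2 - m| * \1_between z.

Let mfst : measurable_fun [set: measurableTypeR R * measurableTypeR R]
  (fun z => z.1 : R). Proof. exact: measurable_fst. Qed.

Let msnd : measurable_fun [set: measurableTypeR R * measurableTypeR R]
  (fun z => z.2 : R). Proof. exact: measurable_snd. Qed.

Let measurable_between : measurable between.
Proof.
have mset (b : measurableTypeR R * measurableTypeR R -> bool) :
    measurable_fun setT b -> measurable [set z | b z].
  by move=> mb; have := mb measurableT [set true] I; rewrite setTI.
apply: measurableU; apply: mset; apply: measurable_and.
- exact: measurable_fun_ler.
- exact: measurable_fun_ltr.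
- exact: measurable_fun_ler.
- exact: measurable_fun_ltr.
Qed.

Let mk : measurable_fun [set: measurableTypeR R * measurableTypeR R] k.
Proof.
apply: measurable_funM; last exact: measurable_indic.
by apply: measurableT_comp => //; exact: measurable_funB.
Qed.

Let k_ge0 z : 0 <= k z.
Proof. by rewrite mulr_ge0 ?indicE. Qed.

(** The fundamental theorem of calculus; the signs of the two cases are absorbed
    by the absolute value in [k]. *)
Let integral_k_derive1 (f : R -> R) (y : R) :
  (forall x, derivable f x 1) -> continuous (derive1 f) ->
  (\int[leb]_x (k (x, y) * derive1 f x)%:E = ((y - m) * (f y - f m))%:E)%E.
Proof.
move=> df cf'.
have FTC (a b : R) : a < b -> (\int[leb]_(x in `[a, b[) (derive1 f x)%:E = (f b - f a)%:E)%E.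
  move=> ab; rewrite integral_itv_bndo_bndc; last first.
    apply/measurable_EFinP; apply: measurable_funTS.
    exact: continuous_measurable_fun.
  rewrite EFinB; apply: (@continuous_FTC2 R (derive1 f) f a b ab).
  - by apply: continuous_subspaceT.
  - split => [x _||]; first exact: df.
      apply: cvg_at_right_filter; apply: differentiable_continuous.
      exact/derivable1_diffP.
    apply: cvg_at_left_filter; apply: differentiable_continuous.
    exact/derivable1_diffP.
  - by [].
have sect (a b c : R) : a < b ->
    (\int[leb]_(x in `[a, b[) (c * derive1 f x)%:E = (c * (f b - f a))%:E)%E.
  move=> ab; under eq_integral do rewrite EFinM.
  rewrite integralZl//; first by rewrite FTC.
  apply: (@integrableS _ _ _ leb `[a, b]) => //.
    by apply: subset_itvl; rewrite bnd_simp.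
  apply: continuous_compact_integrable; first exact: segment_compact.
  exact: continuous_subspaceT.
have [ym|my|->] := ltgtP y m.
- rewrite (_ : (y - m) * (f y - f m) = (m - y) * (f m - f y)); last by ring.
  rewrite -sect// [RHS]integral_mkcond; apply: eq_integral => x _.
  rewrite patchE /k /= ltr0_norm ?subr_lt0// opprB indicE.
  case: ifPn => xym.
    by rewrite mem_set ?mulr1//; right; move: xym; rewrite inE/= in_itv.
  rewrite memNset ?mulr0 ?mul0r// => -[] /= /andP[h1 h2].
    by move: (lt_trans ym (le_lt_trans h1 h2)); rewrite ltxx.
  by move: xym; rewrite mem_set//= in_itv/= h1.
- rewrite -sect// [RHS]integral_mkcond; apply: eq_integral => x _.
  rewrite patchE /k /= gtr0_norm ?subr_gt0// indicE.
  case: ifPn => xym.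
    by rewrite mem_set ?mulr1//; left; move: xym; rewrite inE/= in_itv.
  rewrite memNset ?mulr0 ?mul0r// => -[] /= /andP[h1 h2].
    by move: xym; rewrite mem_set//= in_itv/= h1.
  by move: (lt_trans my (le_lt_trans h1 h2)); rewrite ltxx.
- rewrite subrr mul0r; apply: integral0_eq => x _.
  by rewrite /k /= subrr normr0 !mul0r.
Qed.

Let integral_k (y : R) : (\int[leb]_x (k (x, y))%:E = ((y - m) ^+ 2)%:E)%E.
Proof.
rewrite expr2 -(@integral_k_derive1 id) ?derive1_id.
- by apply: eq_integral => x _; rewrite mulr1.
- by move=> x; exact: derivable_id.
- by move=> x; exact: cvg_cst.
Qed.

Let mu_k (x : R) : mu.-integrable setT (EFin \o (fun y => k (x, y))).
Proof.
apply: (le_integrable measurableT _ _ i1).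
  by apply/measurable_EFinP; apply: (measurableT_comp mk); exact: pair1_measurable.
move=> y _ /=; rewrite lee_fin ger0_norm//.
by rewrite /k /= ler_piMr// indicE; case: (_ \in _).
Qed.

(** Since [mu] has mean [m], this is the familiar integral of [y - m] over the
    ray [y > x]; in this form it is visibly nonnegative and absolutely
    convergent after integration in [x]. *)
Definition hoeffding_kernel (x : R) : R := \int[mu]_y k (x, y).
Let h := hoeffding_kernel.

Let hE (x : R) : (\int[mu]_y (k (x, y))%:E = (h x)%:E)%E.
Proof.
rewrite /h /hoeffding_kernel /Rintegral fineK//.
exact: integrable_fin_num (mu_k x).
Qed.

Let mh : measurable_fun [set: R] h.
Proof.
apply: measurableT_comp => //.
have mkE : measurable_fun [set: measurableTypeR R * measurableTypeR R] (EFin \o k).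
  exact/measurable_EFinP.
by apply: (@measurable_fun_fubini_tonelli_F _ _ (measurableTypeR R)
  (measurableTypeR R) R mu (EFin \o k)) => //.
Qed.

Section Test.
Variables (f : R -> R) (M : R).
Hypothesis df : forall x, derivable f x 1.
Hypothesis cf' : continuous (derive1 f).
Hypothesis f'M : forall x, `|derive1 f x| <= M.

Let mf' : measurable_fun [set: R] (derive1 f).
Proof. exact: continuous_measurable_fun. Qed.

Let mf : measurable_fun [set: R] f.
Proof.
apply: continuous_measurable_fun => x; apply: differentiable_continuous.
exact/derivable1_diffP.
Qed.

Let G (z : measurableTypeR R * measurableTypeR R) := (k z * derive1 f z.1)%:E.

Let iG : (leb \x mu)%E.-integrable setT G.
Proof.
have mG : measurable_fun setT G.
  by apply/measurable_EFinP; apply: measurable_funM => //; exact: measurableT_comp.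
apply/(integrable21ltyP leb mu mG).
apply: (@le_lt_trans _ _ (\int[mu]_y (M * (y - m) ^+ 2)%:E)%E); last first.
  by apply: integrable_lty => //; exact: integrable_scaled.
have mk2 y : measurable_fun [set: measurableTypeR R] (fun x => (k (x, y))%:E).
  have mkE : measurable_fun [set: measurableTypeR R * measurableTypeR R] (EFin \o k).
    exact/measurable_EFinP.
  exact: (measurableT_comp mkE (pair2_measurable _)).
have mG2 y : measurable_fun [set: measurableTypeR R] (fun x => G (x, y)).
  exact: (measurableT_comp mG (pair2_measurable _)).
apply: ge0_le_integral => //.
- by move=> y _; exact: integral_ge0.
- apply: (measurable_fun_fubini_tonelli_G (abse \o G)) => //.
    exact: measurableT_comp.
  by move=> z; exact: abse_ge0.
- exact: (measurable_int mu (integrable_scaled M i2)).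
- move=> y _; rewrite EFinM -integral_k -ge0_integralZl//.
  + apply: ge0_le_integral => //.
    * exact: measurableT_comp.
    * exact: measurable_funeM.
    * move=> x _; rewrite -EFinM /G abse_EFin lee_fin normrM.
      by rewrite [`|k _|]ger0_norm// mulrC ler_wpM2r.
  + by move=> x _; rewrite lee_fin.
  + by rewrite lee_fin (le_trans (normr_ge0 (derive1 f 0))).
Qed.

Lemma integrable_hoeffding_derive1 :
  leb.-integrable setT (EFin \o (fun x => h x * derive1 f x)).
Proof.
have := integrable_fubini_F iG; apply: eq_integrable => // x _.
rewrite /fubini_F /G /=.
under eq_integral do rewrite EFinM.
by rewrite integralZr ?hE//; exact: mu_k.
Qed.

Lemma integrable_centered_mul : mu.-integrable setT (EFin \o (fun y => (y - m) * f y)).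
Proof.
have ib : mu.-integrable setT
    (EFin \o (fun y => M * (y - m) ^+ 2 + `|f m| * `|y - m|)).
  apply: integrable_Radd; first exact: integrable_scaled.
  by apply: integrable_scaled; exact: (integrable_norm i1).
apply: (le_integrable measurableT _ _ ib).
  by apply/measurable_EFinP; apply: measurable_funM => //; exact: measurable_funB.
move=> y _ /=; rewrite lee_fin normrM.
have M0 : 0 <= M by rewrite (le_trans (normr_ge0 (derive1 f 0))).
rewrite [leRHS]ger0_norm; last by rewrite addr_ge0// mulr_ge0// sqr_ge0.
have L : `|f y| <= M * `|y - m| + `|f m|.
  have := derive1_bounded_lipschitz df f'M m y.
  by have := ler_normD (f y - f m) (f m); rewrite subrK; lra.
apply: (le_trans (ler_wpM2l (normr_ge0 _) L)).
rewrite mulrDr -[X in _ <= M * X + _]real_normK ?num_real//.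
by rewrite mulrCA -expr2 [`|f m| * _]mulrC.
Qed.

(** Fubini's theorem, after replacing [f y] by [f y - f m], which is harmless
    because [y - m] has integral 0. *)
Lemma integral_hoeffding_derive1 :
  (\int[leb]_x (h x * derive1 f x)%:E = \int[mu]_y ((y - m) * f y)%:E)%E.
Proof.
transitivity (\int[leb]_x \int[mu]_y G (x, y))%E.
  apply: eq_integral => x _; rewrite /G /=.
  under [RHS]eq_integral do rewrite EFinM.
  by rewrite integralZr ?hE//; exact: mu_k.
rewrite (Fubini iG).
transitivity (\int[mu]_y ((y - m) * f y - f m * (y - m))%:E)%E.
  apply: eq_integral => y _; rewrite integral_k_derive1//.
  by congr EFin; ring.
rewrite -[LHS]fineK; last first.
  apply: integrable_fin_num => //.
  by apply: integrable_Rsub; [exact: integrable_centered_mul|exact: integrable_scaled].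
rewrite -[RHS]fineK; last by apply: integrable_fin_num => //; exact: integrable_centered_mul.
congr EFin; rewrite -/(Rintegral mu setT (fun y => (y - m) * f y - f m * (y - m))).
rewrite RintegralB//; [|exact: integrable_centered_mul|exact: integrable_scaled].
by rewrite RintegralZl// centered mulr0 subr0.
Qed.
End Test.

Let ae_notin (la : {measure set (measurableTypeR R) -> \bar R}) (A : set (measurableTypeR R)) :
  measurable A -> la A = 0%E -> \forall x \ae la, ~ A x.
Proof. by move=> mA A0; exists A; split => // x /= /contrapT. Qed.

Let ae_False : (\forall x \ae mu, False) -> False.
Proof.
move=> [A [mA A0 sub]].
have AT : A = setT by apply/seteqP; split => // x _; apply: sub.
by move: A0; rewrite AT [X in X = _](probability_setT mu) => /eqP; rewrite onee_eq0.
Qed.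

(** A centered variable of constant sign is null. *)
Let ae_mean : (\forall x \ae mu, m <= x) \/ (\forall x \ae mu, x <= m) ->
  \forall x \ae mu, x = m.
Proof.
move=> sgn; have i0 : (\int[mu]_x (x - m)%:E = 0)%E.
  rewrite -[LHS]fineK; last by apply: integrable_fin_num => //; exact: i1.
  by rewrite -/(Rintegral mu setT (fun x => x - m)) centered.
have mi : measurable_fun [set: measurableTypeR R] (fun x : R => (x - m)%:E).
  exact: (measurable_int mu i1).
suff /(ae_eq_integral_abs mu measurableT mi) :
    (\int[mu]_x `|(x - m)%:E| = 0)%E.
  by apply: filterS => x /(_ I) [] /eqP; rewrite subr_eq0 => /eqP.
case: sgn => sgn.
- rewrite -i0; apply: ae_eq_integral => //; first exact: measurableT_comp.
  apply: (@filterS _ _ (ae_filter_ringOfSetsType mu)) sgn => x mx _ /=.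
  by rewrite ger0_norm// subr_ge0.
- have i0N : (\int[mu]_x (- (x - m)%:E) = 0)%E.
    by rewrite integralN ?i0 ?oppe0//; exact: (integrable_add_def measurableT i1).
  rewrite -i0N; apply: ae_eq_integral => //.
  + exact: measurableT_comp.
  + exact: measurableT_comp.
  apply: (@filterS _ _ (ae_filter_ringOfSetsType mu)) sgn => x mx _ /=.
  by rewrite ler0_norm// subr_le0.
Qed.

Let mass_left x : m <= x -> mu `]-oo, x]%classic != 0%E.
Proof.
move=> mx; apply/eqP => mu0; apply: ae_False.
have xy := ae_notin (measurable_itv `]-oo, x]) mu0.
have ym : \forall y \ae mu, y = m.
  apply: ae_mean; left; apply: filterS xy => y /=.
  by rewrite in_itv/= => /negP; rewrite -ltNge => /ltW; exact: le_trans.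
apply: (@filterS2 _ _ (ae_filter_ringOfSetsType mu) _ _ _ _ xy ym).
by move=> y /= + yE; rewrite yE in_itv/= mx.
Qed.

Let mass_right x : x < m -> mu `]x, +oo[%classic != 0%E.
Proof.
move=> xm; apply/eqP => mu0; apply: ae_False.
have xy := ae_notin (measurable_itv `]x, +oo[) mu0.
have ym : \forall y \ae mu, y = m.
  apply: ae_mean; right; apply: filterS xy => y /=.
  by rewrite in_itv/= andbT => /negP; rewrite -leNgt => /le_trans; apply; exact: ltW.
apply: (@filterS2 _ _ (ae_filter_ringOfSetsType mu) _ _ _ _ xy ym).
by move=> y /= + yE; rewrite yE in_itv/= xm.
Qed.

Let hoeffding0 x (A : set (measurableTypeR R)) : measurable A -> mu A = 0%E ->
  (forall y, ~ A y -> ~ between (x, y)) -> h x = 0.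
Proof.
move=> mA A0 sub; rewrite /h /hoeffding_kernel /Rintegral.
rewrite (@ae_eq_integral _ _ _ mu setT (cst 0%E)) ?integral0//.
  exact: (measurable_int mu (mu_k x)).
apply: filterS (ae_notin mA A0) => y nA _.
by rewrite /k indicE memNset ?mulr0//; exact: sub.
Qed.

(** One ray is the section of [between] at [x]; the other one has mass because
    it reaches beyond the mean. *)
Lemma hoeffding_kernel_support x : h x != 0 ->
  mu `]-oo, x]%classic != 0%E /\ mu `]x, +oo[%classic != 0%E.
Proof.
move=> hx; have [mx|xm] := leP m x; split.
- exact: mass_left.
- apply/eqP => mu0; move/eqP: hx; apply.
  apply: (hoeffding0 _ mu0) => // y /=; rewrite in_itv/= andbT => xy [] /= /andP[] //.
  by move=> _ /(le_lt_trans mx); rewrite ltxx.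
- apply/eqP => mu0; move/eqP: hx; apply.
  apply: (hoeffding0 _ mu0) => // y /=; rewrite in_itv/= => xy [] /= /andP[] //.
  by move=> /(lt_le_trans xm); rewrite ltxx.
- exact: mass_right.
Qed.

(** [a] and [b] are the essential bounds, described by the rays that carry
    mass: this is the form in which [hoeffding_kernel_support] meets them. *)
Lemma law_stein_kernel_exists (mu_ac mu_s : {measure set (measurableTypeR R) -> \bar R})
    (p : R -> R) (a b : \bar R) :
  lebesgue_decomposition mu mu_ac mu_s -> has_density mu_ac p ->
  (forall x, mu `]-oo, x]%classic != 0%E -> (a <= x%:E)%E) ->
  (forall x, mu `]x, +oo[%classic != 0%E -> (x%:E <= b)%E) ->
  (forall x, (a < x%:E)%E -> (x%:E < b)%E -> 0 < p x) ->
  exists tau, law_stein_kernel mu m tau.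
Proof.
move=> [_ [N [mN sN0 N0]] muE] [mp p0 pE] ax xb p_gt0.
have mNC : measurable (~` N) by exact: measurableC.
pose tau x := h x * (p x)^-1 * \1_(~` N) x.
have mtau : measurable_fun [set: R] tau.
  apply: measurable_funM; last exact: measurable_indic.
  apply: measurable_funM => //.
  apply: (eq_measurable_fun (fun x => p x `^ (-1))).
    by move=> x _; rewrite powR_inv1.
  exact: (measurableT_comp (measurable_powR _) mp).
(* division by [p x] is harmless except at the two endpoints, where [h] may be
   positive and [p] zero *)
have tau_p : \forall x \ae leb, tau x * p x = h x.
  have a0 := ae_notin (measurable_set1 (fine a)) (lebesgue_measure_set1 (fine a)).
  have b0 := ae_notin (measurable_set1 (fine b)) (lebesgue_measure_set1 (fine b)).
  have n0 := ae_notin mN N0.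
  apply: (@filterS3 _ _ (ae_filter_ringOfSetsType leb) _ _ _ _ _ a0 b0 n0).
  move=> x xa xb' xN.
  rewrite /tau indicE mem_set// mulr1.
  have [->|hx] := eqVneq (h x) 0; first by rewrite !mul0r.
  have [/ax ax' /xb xb''] := hoeffding_kernel_support hx.
  rewrite mulfVK// gt_eqF//; apply: p_gt0.
    by rewrite lt_neqAle ax' andbT; apply/eqP => ea; apply: xa; rewrite ea.
  by rewrite lt_neqAle xb'' andbT; apply/eqP => eb; apply: xb'; rewrite -eb.
(* on the complement of [N] the law is its absolutely continuous part *)
have density (g : R -> \bar R) : measurable_fun [set: R] g ->
    (forall x, N x -> g x = 0%E) ->
    (\int[mu]_x g x = \int[leb]_x (g x * (p x)%:E))%E.
  move=> mg gN; rewrite -(@integral_density _ (measurableTypeR R) R leb mu_ac p mp p0 pE g mg).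
  have gE : g = g \_ (~` N).
    apply/funext => x; rewrite patchE; case: ifPn => //.
    by rewrite notin_setE /= => /contrapT; exact: gN.
  rewrite gE -integral_mkcond -[RHS]integral_mkcond; apply: eq_measure_integral => A mA AN.
  rewrite muE// [X in (_ + X)%E](_ : _ = 0%E) ?adde0//.
  by apply/eqP; rewrite -measure_le0 -sN0 le_measure ?inE.
exists tau; split => // f df cf' [M f'M].
have mf' : measurable_fun [set: R] (derive1 f) by exact: continuous_measurable_fun.
have mg : measurable_fun [set: R] (fun x => tau x * derive1 f x) by exact: measurable_funM.
have gN x : N x -> tau x * derive1 f x = 0.
  by move=> Nx; rewrite /tau indicE memNset ?mulr0 ?mul0r//; exact.
have mgE : measurable_fun [set: R] (fun x => (tau x * derive1 f x)%:E).
  exact/measurable_EFinP.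
have mpE : measurable_fun [set: R] (fun x => (p x)%:E) by exact/measurable_EFinP.
have mhf : measurable_fun [set: R] (fun x => (h x * derive1 f x)%:E).
  by apply/measurable_EFinP; exact: measurable_funM.
split.
- apply/integrableP; split => //.
  have -> : (\int[mu]_x `|(tau x * derive1 f x)%:E| =
             \int[leb]_x `|(h x * derive1 f x)%:E|)%E.
    rewrite (density (fun x => `|(tau x * derive1 f x)%:E|%E)).
    + apply: ae_eq_integral.
      * exact: measurableT.
      * by apply: emeasurable_funM; [exact: measurableT_comp|exact: mpE].
      * exact: measurableT_comp.
      apply: (@filterS _ _ (ae_filter_ringOfSetsType leb)) tau_p => x tp _.
      rewrite !abse_EFin -EFinM -tp; congr EFin.
      by rewrite !normrM (ger0_norm (p0 x)) mulrAC.
    + exact: measurableT_comp.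
    + by move=> x Nx; rewrite gN// abse0.
  have ih := integrable_hoeffding_derive1 cf' f'M.
  have [_ fin] := elimT (integrableP _ _ _) ih.
  exact: fin.
- exact: (integrable_centered_mul df f'M).
- rewrite (density (fun x => (tau x * derive1 f x)%:E) mgE); last first.
    by move=> x Nx; rewrite gN.
  rewrite -(integral_hoeffding_derive1 df cf' f'M).
  apply: ae_eq_integral.
  + exact: measurableT.
  + exact: emeasurable_funM.
  + exact: mhf.
  apply: (@filterS _ _ (ae_filter_ringOfSetsType leb)) tau_p => x tp _.
  by rewrite -EFinM -tp; congr EFin; rewrite mulrAC.
Qed.

End Existence.

(** * Sums of independent variables *)

Section SumDefinitions.
Local Open Scope ring_scope.
Context (R : realType) (d : measure_display) (T : measurableType d).
Context (P : probability T R) (n : nat) (X : 'I_n -> {RV P >-> R}).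

Definition affine_sum (m c : R) (w : T) : R :=
  c * (\sum_(j < n) X j w - n%:R * m).

(** The conditional expectation of this variable given [affine_sum m c] is a
    Stein kernel of the law of [affine_sum m c]. *)
Definition kernel_sum (c : R) (tau : R -> R) (w : T) : R :=
  c ^+ 2 * \sum_(j < n) tau (X j w).

Lemma measurable_affine_sum m c : measurable_fun [set: T] (affine_sum m c).
Proof.
apply: measurable_funM => //; apply: measurable_funB => //.
exact: measurable_sum.
Qed.

End SumDefinitions.

Section SumIdentity.
Local Open Scope ring_scope.
Context (R : realType) (mu : probability (measurableTypeR R) R).
Context (d : measure_display) (T : measurableType d) (P : probability T R).
Variables (n : nat) (X : 'I_n -> {RV P >-> R}).
Hypothesis X_indep : independent_RVs X.
Hypothesis X_law : forall j, has_law (X j) mu.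
Variables (m c : R) (tau : R -> R).
Hypothesis tau_kernel : law_stein_kernel mu m tau.
Variable f : R -> R.
Hypothesis df : forall x, derivable f x 1.
Hypothesis cf' : continuous (derive1 f).
Variables K M : R.
Hypothesis f_bounded : forall x, `|f x| <= K.
Hypothesis f'_bounded : forall x, `|derive1 f x| <= M.

Let S := affine_sum X m c.

(** With the other summands frozen, [f] composed with the sum is a function of
    [X j] alone, whose derivative is [c * f'] by the chain rule. *)
Lemma coordinate_identity j :
  \int[P]_w ((X j w - m) * f (S w)) =
  c * \int[P]_w (tau (X j w) * derive1 f (S w)).
Proof.
pose Y w := c * (\sum_(i < n | i != j) X i w - n%:R * m).
have SE w : S w = c * X j w + Y w.
  by rewrite /S /affine_sum /Y (bigD1 j)//= -mulrDr addrA.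
have mY : measurable_fun [set: g_sigma_algebraType (other_cylinders X j)] Y.
  apply: measurable_funM => //; apply: measurable_funB => //.
  rewrite (_ : (fun w => \sum_(i < n | i != j) X i w) =
    fun w => \sum_(i < n) (if i != j then X i else cst 0) w); last first.
    by apply/funext => w; rewrite big_mkcond; apply: eq_bigr => i _; case: ifP.
  apply: measurable_sum => i; case: ifP => ij //.
  exact: measurable_other.
have mtau : measurable_fun [set: R] tau by case: tau_kernel.
have mf : measurable_fun [set: R] f.
  by apply: continuous_measurable_fun; exact: derivable_continuous.
have mf' : measurable_fun [set: R] (derive1 f).
  exact: continuous_measurable_fun.
have mS : measurable_fun [set: T] S by exact: measurable_affine_sum.
have iX : P.-integrable setT (EFin \o (fun w => X j w - m)).
  apply: (integrable_law (X_law j) _).2 (law_stein_kernel_centered tau_kernel).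
  by apply/measurable_EFinP; exact: measurable_funB.
have itau : P.-integrable setT (EFin \o (fun w => tau (X j w))).
  apply: (integrable_law (X_law j) _).2 (law_stein_kernel_integrable tau_kernel).
  exact/measurable_EFinP.
have iG : P.-integrable setT (EFin \o (fun w => (X j w - m) * f (S w))).
  apply: (integrable_boundedM (K := K)) => //; exact: measurableT_comp.
have iH : P.-integrable setT (EFin \o (fun w => tau (X j w) * derive1 f (S w))).
  apply: (integrable_boundedM (K := M)) => //; exact: measurableT_comp.
rewrite -RintegralZl// /Rintegral; congr fine.
have := @integral_other_eq _ _ _ P n X X_indep j mu Y
  (fun z => (z.1 - m) * f (c * z.1 + z.2))
  (fun z => c * (tau z.1 * derive1 f (c * z.1 + z.2))) mY (X_law j).
have mfst : measurable_fun [set: measurableTypeR R * measurableTypeR R]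
    (fun z => z.1 : R) by exact: measurable_fst.
have msnd : measurable_fun [set: measurableTypeR R * measurableTypeR R]
    (fun z => z.2 : R) by exact: measurable_snd.
have maff : measurable_fun [set: measurableTypeR R * measurableTypeR R]
    (fun z => c * z.1 + z.2 : R).
  by apply: measurable_funD => //; apply: measurable_funM.
move=> /(_ _ _ _ _ _)/= h.
under eq_integral do rewrite SE.
under [RHS]eq_integral do rewrite SE.
apply: h.
- apply: measurable_funM; first exact: measurable_funB.
  exact: (measurableT_comp mf).
- apply: measurable_funM => //; apply: measurable_funM.
    exact: (measurableT_comp mtau).
  exact: (measurableT_comp mf').
- by apply: eq_integrable iG => // w _ /=; rewrite SE.
- by apply: eq_integrable (integrable_scaled c iH) => // w _ /=; rewrite SE.
move=> y; have D x := derive1_affine c y x df.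
have D1 x : derive1 (fun t => f (c * t + y)) x = c * derive1 f (c * x + y).
  by rewrite derive1E; have [_ ->] := D x.
have [_ /(_ (fun t => f (c * t + y)))[]] := tau_kernel.
- by move=> x; have [] := D x.
- rewrite (_ : derive1 _ = fun x => c * derive1 f (c * x + y)); last exact/funext.
  move=> x; apply: cvgM; first exact: cvg_cst.
  apply: (@continuous_comp _ _ _ (fun t => c * t + y) (derive1 f)); last exact: cf'.
  apply: cvgD; last exact: cvg_cst.
  by apply: cvgM; [exact: cvg_cst|exact: cvg_id].
- by exists (`|c| * M) => x; rewrite D1 normrM ler_wpM2l.
move=> _ _ <-; apply: eq_integral => x _; rewrite D1.
by rewrite mulrCA.
Qed.
End SumIdentity.

Section Discrepancy.
Local Open Scope ring_scope.
Context (R : realType) (mu : probability (measurableTypeR R) R).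
Context (d : measure_display) (T : measurableType d) (P : probability T R).
Variables (n : nat) (X : 'I_n -> {RV P >-> R}).
Hypothesis X_indep : independent_RVs X.
Hypothesis X_law : forall j, has_law (X j) mu.
Variables (m c : R) (tau : R -> R).
Hypothesis tau_kernel : law_stein_kernel mu m tau.
Notation leb := (@lebesgue_measure R).

Let S := affine_sum X m c.
Let W := kernel_sum X c tau.

Let mtau : measurable_fun [set: R] tau. Proof. by case: tau_kernel. Qed.

Let mS : measurable_fun [set: T] S.
Proof. exact: measurable_affine_sum. Qed.

Let itau j : P.-integrable setT (EFin \o (fun w => tau (X j w))).
Proof.
apply: (integrable_law (X_law j) _).2 (law_stein_kernel_integrable tau_kernel).
exact/measurable_EFinP.
Qed.

Let iW : P.-integrable setT (EFin \o W).
Proof. by apply: integrable_scaled; exact: integrable_Rsum. Qed.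

Let i1W : P.-integrable setT (EFin \o (fun w => 1 - W w)).
Proof.
apply: integrable_Rsub iW.
exact: finite_measure_integrable_cst.
Qed.

(** The Stein equation at [S] turns the left-hand side into the mean of
    [(1 - W) * f' S]. *)
Lemma stein_discrepancy (h : R -> R) :
  continuous h -> (forall x, 0 <= h x <= 1) ->
  `|\int[P]_w h (S w) - \int[leb]_t (h t * normal_pdf 0 1 t)|
    <= 2 * \int[P]_w `|1 - W w|.
Proof.
move=> ch h01; have [f [df cf' f'2 [K fK] fE]] := stein_solution ch h01.
set N := \int[leb]_t _ in fE *.
have mf : measurable_fun [set: R] f.
  by apply: continuous_measurable_fun; exact: derivable_continuous.
have mf' : measurable_fun [set: R] (derive1 f).
  exact: continuous_measurable_fun.
have mh : measurable_fun [set: R] h by exact: continuous_measurable_fun.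
have iX j : P.-integrable setT (EFin \o (fun w => X j w - m)).
  apply: (integrable_law (X_law j) _).2 (law_stein_kernel_centered tau_kernel).
  by apply/measurable_EFinP; exact: measurable_funB.
have iXf j : P.-integrable setT (EFin \o (fun w => (X j w - m) * f (S w))).
  apply: (integrable_boundedM (K := K)) => //; exact: measurableT_comp.
have itf j : P.-integrable setT (EFin \o (fun w => tau (X j w) * derive1 f (S w))).
  apply: (integrable_boundedM (K := 2)) => //; exact: measurableT_comp.
have iWf : P.-integrable setT (EFin \o (fun w => W w * derive1 f (S w))).
  apply: (integrable_boundedM (K := 2)) => //; exact: measurableT_comp.
have if' : P.-integrable setT (EFin \o (fun w => derive1 f (S w))).
  by apply: (integrable_bounded _ (K := 2)) => //; exact: measurableT_comp.
have SfE w : S w * f (S w) = \sum_(j < n) c * ((X j w - m) * f (S w)).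
  rewrite /S /affine_sum -mulr_sumr -mulr_suml mulrA; congr (_ * _ * _).
  by rewrite big_split/= sumr_const card_ord mulNrn mulr_natl.
have iSf : P.-integrable setT (EFin \o (fun w => S w * f (S w))).
  apply: (eq_integrable measurableT (EFin \o
    (fun w => \sum_(j < n) c * ((X j w - m) * f (S w))))).
    by move=> w _; rewrite /= SfE.
  by apply: integrable_Rsum => j; exact: integrable_scaled.
have E1 : \int[P]_w (S w * f (S w)) = \int[P]_w (W w * derive1 f (S w)).
  under eq_Rintegral do rewrite SfE.
  rewrite Rintegral_sum; last by move=> j; exact: integrable_scaled.
  rewrite [RHS](_ : _ = \int[P]_w \sum_(j < n) (c ^+ 2 * (tau (X j w) * derive1 f (S w)))).
    rewrite Rintegral_sum; last by move=> j; exact: integrable_scaled.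
    apply: eq_bigr => j _; rewrite !RintegralZl// expr2 -mulrA; congr (_ * _).
    exact: (coordinate_identity X_indep X_law c tau_kernel df cf' fK f'2).
  by apply: eq_Rintegral => w _; rewrite -mulr_sumr -mulr_suml mulrA.
have ih : P.-integrable setT (EFin \o (fun w => h (S w))).
  apply: (integrable_bounded _ (K := 1)) => [|w]; first exact: measurableT_comp.
  by have /andP[h0 h1] := h01 (S w); rewrite ger0_norm.
have -> : \int[P]_w h (S w) - N = \int[P]_w ((1 - W w) * derive1 f (S w)).
  have -> : N = \int[P]_w N.
    by rewrite Rintegral_cst_probability.
  rewrite -RintegralB//; last exact: finite_measure_integrable_cst.
  transitivity (\int[P]_w (derive1 f (S w) - S w * f (S w))).
    by apply: eq_Rintegral => w _; rewrite fE.
  rewrite RintegralB// E1 -RintegralB//.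
  by apply: eq_Rintegral => w _; rewrite mulrBl mul1r.
have i1Wf : P.-integrable setT (EFin \o (fun w => (1 - W w) * derive1 f (S w))).
  apply: (integrable_boundedM (K := 2)) => //; exact: measurableT_comp.
apply: (le_trans (le_normr_Rintegral measurableT i1Wf)).
rewrite -RintegralZl//; last exact: integrable_norm.
apply: le_Rintegral => //.
- exact: integrable_norm.
- by apply: integrable_scaled; exact: integrable_norm.
- by move=> w _; rewrite normrM mulrC ler_wpM2r.
Qed.

Let s2 := \int[mu]_x tau x.
Hypothesis c_norm : c ^+ 2 * n%:R * s2 = 1.
Hypothesis tau_sqr : mu.-integrable setT (EFin \o (fun x => (tau x - s2) ^+ 2)).
Let V := \int[mu]_x (tau x - s2) ^+ 2.

(** [1 - W] is a multiple of a sum of independent centered variables, whose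
    cross terms have mean 0. *)
Lemma mean_sqr_discrepancy :
  P.-integrable setT (EFin \o (fun w => (1 - W w) ^+ 2)) /\
  \int[P]_w (1 - W w) ^+ 2 = c ^+ 4 * n%:R * V.
Proof.
pose u x := tau x - s2.
have mu_ : measurable_fun [set: R] u by exact: measurable_funB.
have iu : mu.-integrable setT (EFin \o u).
  apply: integrable_Rsub; first exact: law_stein_kernel_integrable tau_kernel.
  exact: finite_measure_integrable_cst.
have u0 : (\int[mu]_x (u x)%:E = 0)%E.
  rewrite -[LHS]fineK; last exact: integrable_fin_num iu.
  rewrite -/(Rintegral mu setT u) RintegralB//.
  - by rewrite Rintegral_cst_probability subrr.
  - exact: law_stein_kernel_integrable tau_kernel.
  - exact: finite_measure_integrable_cst.
have iu2 j : P.-integrable setT (EFin \o (fun w => u (X j w) ^+ 2)).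
  apply: (integrable_law (X_law j) _).2 tau_sqr.
  by apply/measurable_EFinP; exact: measurable_funX.
have muX j : measurable_fun [set: T] (fun w => u (X j w)) by exact: measurableT_comp.
have iuu i j : P.-integrable setT (EFin \o (fun w => u (X i w) * u (X j w))).
  apply: (le_integrable measurableT _ _ (integrable_Radd (iu2 i) (iu2 j))).
    by apply/measurable_EFinP; exact: measurable_funM.
  move=> w _ /=; rewrite lee_fin normrM [leRHS]ger0_norm ?addr_ge0 ?sqr_ge0//.
  rewrite -[X in _ <= X + _]real_normK ?num_real// -[X in _ <= _ + X]real_normK ?num_real//.
  have := sqr_ge0 (`|u (X i w)| - `|u (X j w)|).
  have := normr_ge0 (u (X i w)); have := normr_ge0 (u (X j w)).
  by nra.
have E w : (1 - W w) ^+ 2 =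
    c ^+ 4 * \sum_(i < n) \sum_(j < n) u (X i w) * u (X j w).
  have -> : 1 - W w = - (c ^+ 2 * \sum_(i < n) u (X i w)).
    rewrite -c_norm /W /kernel_sum /u big_split/= sumrN sumr_const card_ord.
    by rewrite -[s2 *+ n]mulr_natl mulrBr opprB mulrA.
  rewrite sqrrN exprMn -exprM; congr (_ * _).
  rewrite expr2 mulr_suml; apply: eq_bigr => i _.
  by rewrite mulr_sumr.
have Euu i j : \int[P]_w (u (X i w) * u (X j w)) = if i == j then V else 0.
  case: (eqVneq i j) => [->|ij].
    rewrite /V /Rintegral; congr fine.
    rewrite -(integral_law (X_law j) (g := fun x => ((tau x - s2) ^+ 2)%:E)).
      by apply: eq_integral => w _; rewrite -expr2.
    by apply/measurable_EFinP; exact: measurable_funX.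
  rewrite /Rintegral.
  have mfst : measurable_fun [set: measurableTypeR R * measurableTypeR R]
    (fun z => z.1 : R) by exact: measurable_fst.
  have msnd : measurable_fun [set: measurableTypeR R * measurableTypeR R]
    (fun z => z.2 : R) by exact: measurable_snd.
  rewrite (@integral_other_eq _ _ _ P n X X_indep j mu (X i)
    (fun z => u z.2 * u z.1) (fun z => 0)) //=.
  - by rewrite integral0.
  - exact: measurable_other.
  - apply: measurable_funM; exact: (measurableT_comp mu_).
  - by apply: integrable0.
  - move=> y; rewrite integral0.
    under eq_integral do rewrite EFinM.
    by rewrite integralZl// u0 mule0.
have iuE : P.-integrable setT
    (EFin \o (fun w => \sum_(i < n) \sum_(j < n) u (X i w) * u (X j w))).
  by apply: integrable_Rsum => i; exact: integrable_Rsum.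
split.
  apply: eq_integrable (integrable_scaled (c ^+ 4) iuE) => // w _.
  by rewrite /= E.
under eq_Rintegral do rewrite E.
rewrite RintegralZl// -mulrA; congr (_ * _).
rewrite Rintegral_sum; last by move=> i; exact: integrable_Rsum.
rewrite -[n in RHS]card_ord mulr_natl -sumr_const; apply: eq_bigr => i _.
rewrite Rintegral_sum//; under eq_bigr do rewrite Euu.
by rewrite -big_mkcond (big_pred1 i)// => k; rewrite eq_sym.
Qed.

Lemma mean_discrepancy :
  \int[P]_w `|1 - W w| <= c ^+ 2 * Num.sqrt (n%:R * V).
Proof.
have [i2 E2] := mean_sqr_discrepancy.
have V0 : 0 <= V by apply: Rintegral_ge0 => x _; exact: sqr_ge0.
set q := c ^+ 2 * Num.sqrt _.
have q0 : 0 <= q by rewrite mulr_ge0 ?sqr_ge0// sqrtr_ge0.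
have q2 : q ^+ 2 = c ^+ 4 * n%:R * V.
  by rewrite exprMn sqr_sqrtr ?mulr_ge0// -exprM mulrA.
(* [z <= (z ^+ 2 / a + a) / 2] with [a] slightly larger than [q], which may
   be 0 *)
apply/ler_addgt0Pr => e e0.
have qe0 : 0 < q + e by rewrite ltr_wpDl.
have -> : q + e = (q + e) / 2 + (q + e) / 2 by rewrite -splitr.
apply: (@le_trans _ _ (\int[P]_w ((2 * (q + e))^-1 * (1 - W w) ^+ 2 + (q + e) / 2))).
  apply: le_Rintegral => //.
  - exact: integrable_norm.
  - apply: integrable_Radd; first exact: integrable_scaled.
    exact: finite_measure_integrable_cst.
  - move=> w _; rewrite -[X in _ <= _ * X + _]real_normK ?num_real//.
    set z := `|_|; rewrite -subr_ge0.
    have -> : (2 * (q + e))^-1 * z ^+ 2 + (q + e) / 2 - z =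
        (2 * (q + e))^-1 * (z - (q + e)) ^+ 2.
      by field; rewrite gt_eqF.
    by rewrite mulr_ge0 ?sqr_ge0// invr_ge0 mulr_ge0 ?ltW.
rewrite RintegralD//; last 2 first.
- exact: integrable_scaled.
- exact: finite_measure_integrable_cst.
rewrite Rintegral_cst_probability RintegralZl// E2 -q2 lerD2r.
rewrite mulrC ler_pdivrMr ?mulr_gt0//.
have -> : (q + e) / 2 * (2 * (q + e)) = (q + e) ^+ 2 by field.
by rewrite ler_pXn2r ?nnegrE// ?lerDl ltW.
Qed.

End Discrepancy.

Section NormalApproximation.
Local Open Scope ring_scope.
Context (R : realType) (mu : probability (measurableTypeR R) R).
Context (d : measure_display) (T : measurableType d) (P : probability T R).
Variables (n : nat) (X : 'I_n -> {RV P >-> R}).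
Hypothesis X_indep : independent_RVs X.
Hypothesis X_law : forall j, has_law (X j) mu.
Variables (m c : R) (tau : R -> R).
Hypothesis tau_kernel : law_stein_kernel mu m tau.
Let s2 := \int[mu]_x tau x.
Let S := affine_sum X m c.
Hypothesis c_norm : c ^+ 2 * n%:R * s2 = 1.
Hypothesis tau_sqr : mu.-integrable setT (EFin \o (fun x => (tau x - s2) ^+ 2)).

Lemma normal_approximation (B : set R) : measurable B ->
  (`|P (S @^-1` B) - normal_prob 0 1 B| <=
    (2 * (c ^+ 2 * Num.sqrt (n%:R * \int[mu]_x (tau x - s2) ^+ 2)))%:E)%E.
Proof.
move=> mB.
have mS : @measurable_fun _ _ T (measurableTypeR R) [set: T] S.
  exact: measurable_affine_sum.
pose S' : {mfun T >-> measurableTypeR R} :=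
  HB.pack S (isMeasurableFun.Build _ _ _ _ _ mS).
pose nu : probability (measurableTypeR R) R := distribution P S'.
apply: (@probability_dist_continuous R nu (normal_prob 0 1)) => // h ch h01.
have mh : measurable_fun [set: R] h by exact: continuous_measurable_fun.
have mhE : measurable_fun [set: measurableTypeR R] (EFin \o h).
  exact: (measurable_EFinP _ _).2 mh.
have -> : \int[nu]_x h x = \int[P]_w h (S w).
  rewrite /Rintegral; congr fine; apply/esym.
  exact: (@integral_image _ _ T (measurableTypeR R) R P nu S mS
    (fun A _ => erefl) (EFin \o h) mhE).
have -> : \int[normal_prob 0 1]_x h x =
    \int[@lebesgue_measure R]_x (h x * normal_pdf 0 1 x).
  rewrite /Rintegral; congr fine.
  rewrite (@integral_density _ (measurableTypeR R) R (@lebesgue_measure R)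
    (normal_prob 0 1) (normal_pdf 0 1) _ _ _ (EFin \o h) mhE)//.
  - exact: measurable_normal_pdf.
  - exact: normal_pdf_ge0.
apply: (le_trans (stein_discrepancy X_indep X_law c tau_kernel ch h01)).
rewrite ler_wpM2l//.
exact: (mean_discrepancy X_indep X_law tau_kernel c_norm tau_sqr).
Qed.

End NormalApproximation.

(** * From random variables to their laws *)

Section LawOfVariable.
Context (R : realType) (mu : probability (measurableTypeR R) R).
Context (d : measure_display) (T : measurableType d) (P : probability T R).
Variable X : {RV P >-> R}.
Hypothesis X_law : has_law X mu.

Lemma expectation_law (g : R -> R) : measurable_fun [set: R] g ->
  'E_P[fun w => g (X w)] = \int[mu]_x (g x)%:E.
Proof.
by move=> mg; rewrite unlock (integral_law X_law (measurableT_comp _ mg)).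
Qed.

Lemma mean_law : fine 'E_P[X] = (\int[mu]_x x)%R.
Proof. by rewrite (@expectation_law id). Qed.

Lemma variance_law (g : R -> R) : measurable_fun [set: R] g ->
  'V_P[fun w => g (X w)] = \int[mu]_x ((g x - (\int[mu]_x g x)%R) ^+ 2)%:E.
Proof.
move=> mg; rewrite /variance unlock expectation_law//.
rewrite (_ : (_ * _)%R = fun w => (g (X w) - (\int[mu]_x g x)%R) ^+ 2)%R.
  rewrite (@expectation_law (fun x => (g x - (\int[mu]_x g x)%R) ^+ 2)%R)//.
  by apply: measurable_funX; exact: measurable_funB.
by apply/funext => w; rewrite expr2.
Qed.

Lemma square_integrable_law : 'E_P[fun w => (X w ^+ 2)%R] < +oo ->
  mu.-integrable setT (EFin \o (fun x => x ^+ 2)%R).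
Proof.
have mX2 : measurable_fun [set: R] (fun x : R => x ^+ 2)%R.
  exact: measurable_funX.
rewrite (expectation_law mX2) => fin; apply/integrableP; split.
  exact/measurable_EFinP.
by under eq_integral do rewrite /= ger0_norm ?sqr_ge0//.
Qed.

Lemma stein_kernel_law (tau : R -> R) :
  stein_kernel X tau <-> law_stein_kernel mu (\int[mu]_x x)%R tau.
Proof.
rewrite /stein_kernel mean_law; set m := (\int[mu]_x x)%R.
have equiv : measurable_fun [set: R] tau -> forall f : R -> R,
   (forall x, derivable f x 1%R) -> continuous (derive1 f) ->
   [/\ P.-integrable setT (EFin \o (fun w => tau (X w) * derive1 f (X w))%R),
       P.-integrable setT (EFin \o (fun w => (X w - m) * f (X w))%R)
     & 'E_P[fun w => (tau (X w) * derive1 f (X w))%R] =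
       'E_P[fun w => ((X w - m) * f (X w))%R]] <->
   [/\ mu.-integrable setT (EFin \o (fun x => tau x * derive1 f x)%R),
       mu.-integrable setT (EFin \o (fun x => (x - m) * f x)%R)
     & \int[mu]_x (tau x * derive1 f x)%:E = \int[mu]_x ((x - m) * f x)%:E].
  move=> mtau f df cf'.
  have mf : measurable_fun [set: R] f.
    apply: continuous_measurable_fun => x; apply: differentiable_continuous.
    exact/derivable1_diffP.
  have mf' : measurable_fun [set: R] (derive1 f) by exact: continuous_measurable_fun.
  have mtf : measurable_fun [set: R] (fun x => tau x * derive1 f x)%R.
    exact: measurable_funM.
  have mxf : measurable_fun [set: R] (fun x => (x - m) * f x)%R.
    by apply: measurable_funM => //; exact: measurable_funB.
  have e1 := expectation_law mtf; have e2 := expectation_law mxf.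
  have l1 := integrable_law X_law ((measurable_EFinP _ _).2 mtf).
  have l2 := integrable_law X_law ((measurable_EFinP _ _).2 mxf).
  split=> -[h1 h2 h3]; split.
  - exact: l1.1 h1.
  - exact: l2.1 h2.
  - by rewrite -e1 -e2.
  - exact: l1.2 h1.
  - exact: l2.2 h2.
  - by rewrite e1 e2.
by split=> -[mtau H]; split => // f df cf' f'M; apply/(equiv mtau f df cf')/H.
Qed.

End LawOfVariable.

Section SecondMoment.
Local Open Scope ring_scope.
Context (R : realType) (mu : probability (measurableTypeR R) R).
Hypothesis i2 : mu.-integrable setT (EFin \o (fun x : R => x ^+ 2)).
Let m := \int[mu]_x x.

Lemma integrable_id : mu.-integrable setT (EFin \o (fun x : R => x)).
Proof.
have i1 : mu.-integrable setT (EFin \o (fun x : R => x ^+ 2 + 1)).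
  by apply: integrable_Radd => //; exact: finite_measure_integrable_cst.
apply: (le_integrable measurableT _ _ i1); first exact/measurable_EFinP.
move=> x _; rewrite /= lee_fin [leRHS]ger0_norm ?addr_ge0 ?sqr_ge0//.
rewrite -[X in _ <= X + _]real_normK ?num_real//.
by have := sqr_ge0 (`|x| - 1); have := normr_ge0 x; nra.
Qed.

Lemma integrable_sub_mean : mu.-integrable setT (EFin \o (fun x : R => x - m)).
Proof.
apply: integrable_Rsub; first exact: integrable_id.
exact: finite_measure_integrable_cst.
Qed.

Lemma integral_sub_mean : \int[mu]_x (x - m) = 0.
Proof.
rewrite RintegralB//; [|exact: integrable_id|exact: finite_measure_integrable_cst].
by rewrite Rintegral_cst_probability subrr.
Qed.

Lemma integrable_sub_mean_sqr :
  mu.-integrable setT (EFin \o (fun x : R => (x - m) ^+ 2)).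
Proof.
have i : mu.-integrable setT (EFin \o (fun x : R => x ^+ 2 - (2 * m) * x + m ^+ 2)).
  apply: integrable_Radd; last exact: finite_measure_integrable_cst.
  by apply: integrable_Rsub => //; apply: integrable_scaled; exact: integrable_id.
by apply: eq_integrable i => // x _ /=; congr EFin; ring.
Qed.

Lemma integral_sub_meanM :
  \int[mu]_x ((x - m) * x) = \int[mu]_x (x - m) ^+ 2.
Proof.
transitivity (\int[mu]_x ((x - m) ^+ 2 + m * (x - m))).
  by apply: eq_Rintegral => x _; ring.
have im := integrable_scaled m integrable_sub_mean.
rewrite RintegralD//; last exact: integrable_sub_mean_sqr.
by rewrite RintegralZl ?integral_sub_mean ?mulr0 ?addr0//; exact: integrable_sub_mean.
Qed.

End SecondMoment.

(** * The normal approximation in total variation *)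

Theorem theorem1p3 (R : realType)
  (mu : probability (measurableTypeR R) R)
  (dX : measure_display) (TX : measurableType dX) (PX : probability TX R)
  (X : {RV PX >-> R}) (X_law : has_law X mu)
  (X_sqr : 'E_PX[fun w => (X w ^+ 2)%R] < +oo)
  (X_var : 0 < 'V_PX[X])
  (mu_ac mu_s : {measure set (measurableTypeR R) -> \bar R})
  (mu_decomp : lebesgue_decomposition mu mu_ac mu_s)
  (p : R -> R) (p_density : has_density mu_ac p)
  (p_gt0 : forall x : R,
     ess_inf PX (EFin \o X) < x%:E -> x%:E < ess_sup PX (EFin \o X) ->
     (0 < p x)%R)
  (n : nat) (n_gt0 : (0 < n)%N)
  (d : measure_display) (Omega : measurableType d) (P : probability Omega R)
  (Xs : 'I_n -> {RV P >-> R})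
  (Xs_indep : independent_RVs Xs)
  (Xs_law : forall j, has_law (Xs j) mu)
  (dZ : measure_display) (TZ : measurableType dZ) (PZ : probability TZ R)
  (Z : {RV PZ >-> R}) (Z_law : has_law Z (normal_prob 0 1)) :
  let sigma : R := Num.sqrt (fine 'V_PX[X]) in
  let m : R := fine 'E_P[Xs (Ordinal n_gt0)] in
  let Sn (w : Omega) : R := (\sum_(j < n) Xs j w)%R in
  let Sn_star (w : Omega) : R :=
    (sigma^-1 * (Num.sqrt n%:R)^-1 * (Sn w - n%:R * m))%R in
  [/\ exists tau : R -> R, stein_kernel X tau,
      forall tau tau' : R -> R, stein_kernel X tau -> stein_kernel X tau' ->
        {ae mu, forall x, tau x = tau' x}
    & forall tau : R -> R, stein_kernel X tau ->
        dTV P PZ Sn_star Z <=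
        (2 / (sigma ^+ 2 * Num.sqrt n%:R))%R%:E * sqrte 'V_PX[tau \o X]].
Proof.
move=> sigma m Sn Sn_star.
have x2 := square_integrable_law X_law X_sqr.
set m0 := (\int[mu]_x x)%R.
have mE : m = m0 by rewrite /m (mean_law (Xs_law _)).
have i1 := integrable_sub_mean x2; have i2 := integrable_sub_mean_sqr x2.
rewrite -/m0 in i1 i2.
have VE : 'V_PX[X] = \int[mu]_x ((x - m0) ^+ 2)%:E.
  exact: (@variance_law _ _ _ _ _ X X_law id).
set v := (\int[mu]_x (x - m0) ^+ 2)%R.
have vE : 'V_PX[X] = v%:E.
  by rewrite VE /v /Rintegral fineK//; exact: (integrable_fin_num _ i2).
have v0 : (0 < v)%R by move: X_var; rewrite vE lte_fin.
have s2E : (sigma ^+ 2 = v)%R by rewrite /sigma vE /= sqr_sqrtr// ltW.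
split.
- have [|||tau ktau] := @law_stein_kernel_exists R mu m0 i1 i2
    (integral_sub_mean x2) mu_ac mu_s p
    (ess_inf PX (EFin \o X)) (ess_sup PX (EFin \o X)) mu_decomp p_density.
  + move=> x; apply: contraNT; rewrite -ltNge => xa.
    rewrite -(X_law `]-oo, x]%classic (measurable_itv _)).
    apply/eqP; rewrite -[LHS]/(PX (X @^-1` `]-oo, x])).
    apply: measure_negligible; first exact: measurable_funPTI.
    apply: negligibleS (ess_inf_le PX (EFin \o X)) => w /=.
    by rewrite in_itv/= => Xx /(lt_le_trans xa); rewrite lte_fin ltNge Xx.
  + move=> x; apply: contraNT; rewrite -ltNge => xa.
    rewrite -(X_law `]x, +oo[%classic (measurable_itv _)).
    apply/eqP; rewrite -[LHS]/(PX (X @^-1` `]x, +oo[)).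
    apply: measure_negligible; first exact: measurable_funPTI.
    apply: negligibleS (ess_sup_ge PX (EFin \o X)) => w /=.
    rewrite in_itv/= andbT => xX /le_lt_trans/(_ xa).
    by rewrite lte_fin ltNge (ltW xX).
  + exact: p_gt0.
  by exists tau; apply/(stein_kernel_law X_law).
- move=> tau tau' /(stein_kernel_law X_law) ktau /(stein_kernel_law X_law).
  exact: law_stein_kernel_unique ktau.
move=> tau /(stein_kernel_law X_law) ktau.
have [mtau _] := ktau.
have s2 : (\int[mu]_x tau x = v)%R.
  by rewrite (law_stein_kernel_mean ktau); exact: integral_sub_meanM.
have n0 : (0 < n%:R :> R)%R by rewrite ltr0n.
have sn0 : (0 < Num.sqrt n%:R :> R)%R by rewrite sqrtr_gt0.
have sigma0 : (0 < sigma)%R by rewrite /sigma sqrtr_gt0 vE.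
have coef0 : (0 < 2 / (sigma ^+ 2 * Num.sqrt n%:R))%R.
  by rewrite divr_gt0// mulr_gt0// exprn_gt0.
have VtauE := variance_law X_law mtau.
rewrite s2 in VtauE.
rewrite (_ : 'V_PX[tau \o X] = \int[mu]_x ((tau x - v) ^+ 2)%:E)//.
have mtv : measurable_fun [set: R] (fun x => (tau x - v) ^+ 2)%R.
  by apply: measurable_funX; exact: measurable_funB.
(* an infinite variance makes the right-hand side infinite *)
have [fin|inf] := ltP (\int[mu]_x ((tau x - v) ^+ 2)%:E) +oo; last first.
  move: inf; rewrite leye_eq => /eqP ->.
  by rewrite /= gt0_muley ?lte_fin// leey.
have itau : mu.-integrable setT (EFin \o (fun x => (tau x - v) ^+ 2)%R).
  apply/integrableP; split; first exact/measurable_EFinP.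
  by under eq_integral do rewrite /= ger0_norm ?sqr_ge0//.
set V := (\int[mu]_x (tau x - v) ^+ 2)%R.
have -> : \int[mu]_x ((tau x - v) ^+ 2)%:E = V%:E.
  by rewrite /V /Rintegral fineK//; exact: (integrable_fin_num _ itau).
pose c := (sigma^-1 * (Num.sqrt n%:R)^-1)%R.
have c2 : (c ^+ 2 = (v * n%:R)^-1)%R.
  by rewrite /c exprMn !exprVn s2E sqr_sqrtr ?ltW// invfM.
have c_norm : (c ^+ 2 * n%:R * \int[mu]_x tau x = 1)%R.
  by rewrite s2 c2; field; rewrite !gt_eqF.
have itau' : mu.-integrable setT
    (EFin \o (fun x => (tau x - \int[mu]_x tau x) ^+ 2)%R) by rewrite s2.
apply: ge_ereal_sup => _ [B mB <-].
have := normal_approximation Xs_indep Xs_law ktau c_norm itau' mB.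
rewrite s2 -/V.
have -> : PZ (Z @^-1` B) = normal_prob 0 1 B by exact: Z_law.
rewrite /Sn_star /Sn mE => /le_trans; apply.
rewrite -EFinM lee_fin s2E c2 sqrtrM ?(ltW n0)// le_eqVlt.
apply/orP; left; apply/eqP.
have nE : (n%:R = Num.sqrt n%:R ^+ 2 :> R)%R by rewrite sqr_sqrtr ?ltW.
by rewrite {1}nE; field; rewrite !gt_eqF.
Qed.
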